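(* For all $u\in\mathbb{C}$ with $0<|u|$ sufficiently small, \[n\!\left(\frac{27u(1+u)^4}{2(1+4u+u^2)^3}\right)+n\!\left(-\frac{27u(1+u)}{2(1-2u-2u^2)^3}\right)=2\,n\!\left(\frac{27u^4(1+u)}{2(2+2u-u^2)^3}\right)-3\,n\!\left(\frac{27u^2(1+u)^2}{4(1+u+u^2)^3}\right).\]
   Context: $n(t)=\mathrm{m}\!\left(x^3+y^3+1-\frac{3}{t^{1/3}}xy\right)$, where $\mathrm{m}$ is the logarithmic Mahler measure $\mathrm{m}(P)=\int_0^1\int_0^1\log|P(e^{2\pi i\theta_1},e^{2\pi i\theta_2})|d\theta_1d\theta_2$ (independent of the choice of cube root). *)

(* Defs.v *)
From HB Require Import structures.
From mathcomp Require Import all_boot all_order all_algebra.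
From mathcomp Require Import all_classical all_reals all_analysis.
From mathcomp Require Import complex.
Set Implicit Arguments. Unset Strict Implicit. Unset Printing Implicit Defensive.
Import Order.TTheory GRing.Theory Num.Theory.
Local Open Scope ring_scope.
Local Open Scope classical_set_scope.

Definition expi2pi (R : realType) (th : R) : R[i] :=
  Complex (cos (2 * pi * th)) (sin (2 * pi * th)).

Definition mahler2 (R : realType) (P : R[i] -> R[i] -> R[i]) : R :=
  Rintegral lebesgue_measure `[0%R, 1%R]
    (fun th1 : R => Rintegral lebesgue_measure `[0%R, 1%R]
      (fun th2 : R => ln (ComplexField.Normc.normc (P (expi2pi th1) (expi2pi th2))))).

Definition hesseP (R : realType) (k : R[i]) (x y : R[i]) : R[i] :=
  x ^+ 3 + y ^+ 3 + 1 - k * x * y.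

(* n(t) = m(x^3 + y^3 + 1 - 3 t^(-1/3) x y), using the principal cube root
   3.-root t (the value does not depend on the choice of cube root). *)
Definition nfun (R : realType) (t : R[i]) : R :=
  mahler2 (hesseP (3 / 3.-root t)).

(* Main.v *)
(* Write k = 3 / t^(1/3) and t = 27 s, so that k^3 = 1/s. On the torus
   x^3 + y^3 + 1 - k x y = - k x y (1 - (x^2/y + y^2/x + 1/(x y)) / k), and
   expanding the logarithm gives, for small s,
     n(27 s) = - (log |s| + Re sum_(m >= 1) a_m s^m / m) / 3,
   with a_m = (3m)! / m!^3. Applying theta = s d/ds to the bracket yields
   A(s) = sum_m a_m s^m = 2F1(1/3, 2/3; 1; 27 s). For the four arguments s_i(u)
   there are quadratic polynomials L_i(u) such that all the A(s_i(u)) / L_i(u)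
   solve one and the same second-order equation with a double exponent 0 at
   u = 0, hence coincide; the theta-derivative of the combination of the four
   logarithms is then a common factor times a sum of polynomials which is
   identically zero.

   No infinite series occurs: every series is truncated at order N, the identities
   hold up to an error O(2^-N) along the segment from 0 to u, and N goes to
   infinity. *)
Require Import Defs.
From HB Require Import structures.
From mathcomp Require Import all_boot all_order all_algebra.
From mathcomp Require Import all_classical all_reals all_analysis.
From mathcomp Require Import complex.
From mathcomp Require Import ring lra zify.
Set Implicit Arguments. Unset Strict Implicit. Unset Printing Implicit Defensive.
Import Order.TTheory GRing.Theory Num.Theory.
Import numFieldNormedType.Exports.
Local Open Scope ring_scope.

Local Notation normc := ComplexField.Normc.normc.

(** * Modulus of complex numbers: components and triangle inequalities *)

Section ComplexNorm.
Context {R : realType}.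
Implicit Types z w : R[i].

Lemma normcE2 z : normc z = Num.sqrt (complex.Re z ^+ 2 + complex.Im z ^+ 2).
Proof. by case: z. Qed.

Lemma cReD z w : complex.Re (z + w) = complex.Re z + complex.Re w.
Proof. by case: z w => ? ? []. Qed.

Lemma cImD z w : complex.Im (z + w) = complex.Im z + complex.Im w.
Proof. by case: z w => ? ? []. Qed.

Lemma cReM z w : complex.Re (z * w) =
  complex.Re z * complex.Re w - complex.Im z * complex.Im w.
Proof. by case: z w => ? ? []. Qed.

Lemma cImM z w : complex.Im (z * w) =
  complex.Re z * complex.Im w + complex.Im z * complex.Re w.
Proof. by case: z w => ? ? []. Qed.

Lemma cReB z w : complex.Re (z - w) = complex.Re z - complex.Re w.
Proof. by case: z w => ? ? []. Qed.

Lemma cRe_natM n z : complex.Re (n%:R * z) = n%:R * complex.Re z.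
Proof. by rewrite !mulr_natl raddfMn. Qed.

Lemma normc_ge0 z : 0 <= normc z.
Proof. by rewrite normcE2 sqrtr_ge0. Qed.

Lemma normc_sqr z : normc z ^+ 2 = complex.Re z ^+ 2 + complex.Im z ^+ 2.
Proof. by rewrite normcE2 sqr_sqrtr// addr_ge0// sqr_ge0. Qed.

Lemma normc_gt0 z : (0 < normc z) = (z != 0).
Proof.
rewrite lt_def normc_ge0 andbT; congr (~~ _); apply/eqP/eqP => [|->].
  exact: ComplexField.Normc.eq0_normc.
exact: ComplexField.Normc.normc0.
Qed.

Lemma ler_Re_normc z : `|complex.Re z| <= normc z.
Proof. by rewrite normcE2 -sqrtr_sqr ler_wsqrtr// lerDl sqr_ge0. Qed.

Lemma ler_Im_normc z : `|complex.Im z| <= normc z.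
Proof. by rewrite normcE2 -sqrtr_sqr ler_wsqrtr// lerDr sqr_ge0. Qed.

Lemma normc_le_ReIm z : normc z <= `|complex.Re z| + `|complex.Im z|.
Proof.
rewrite -(@ler_pXn2r _ 2)// ?nnegrE ?normc_ge0 ?addr_ge0//.
rewrite normc_sqr -(real_normK (num_real (complex.Re z))).
rewrite -(real_normK (num_real (complex.Im z))) sqrrD.
by rewrite lerD2r lerDl mulrn_wge0// mulr_ge0.
Qed.

Lemma normcX z n : normc (z ^+ n) = normc z ^+ n.
Proof.
elim: n => [|n IH]; first by rewrite !expr0 ComplexField.Normc.normc1.
by rewrite !exprS ComplexField.Normc.normcM IH.
Qed.

Lemma normcD_le z w : normc (z + w) <= normc z + normc w.
Proof. exact: le_normcD. Qed.

Lemma normcN_eq z : normc (- z) = normc z.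
Proof. exact: normcN. Qed.

Lemma normcB_le z w : normc (z - w) <= normc z + normc w.
Proof. by rewrite -(normcN_eq w) normcD_le. Qed.

Lemma normcB_ge z w : normc z - normc w <= normc (z - w).
Proof. by rewrite lerBlDr -{1}(subrK w z) normcD_le. Qed.

Lemma normc_real (r : R) : normc (r%:C)%C = `|r|.
Proof. by rewrite normcE2 /= expr0n addr0 sqrtr_sqr. Qed.

Lemma normc_nat n : normc (n%:R : R[i]) = n%:R.
Proof. by rewrite -(rmorph_nat (real_complex R)) normc_real ger0_norm. Qed.

Lemma normc_le_mul (x y : R[i]) (p q : R) :
  normc x <= p -> normc y <= q -> normc (x * y) <= p * q.
Proof. by move=> ? ?; rewrite ComplexField.Normc.normcM ler_pM ?normc_ge0. Qed.

Lemma normc_le_add (x y : R[i]) (p q : R) :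
  normc x <= p -> normc y <= q -> normc (x + y) <= p + q.
Proof. by move=> ? ?; rewrite (le_trans (normcD_le _ _))// lerD. Qed.

Lemma normc_le_sub (x y : R[i]) (p q : R) :
  normc x <= p -> normc y <= q -> normc (x - y) <= p + q.
Proof. by move=> ? ?; rewrite (le_trans (normcB_le _ _))// lerD. Qed.

Lemma normc_le_exp (x : R[i]) (p : R) n : normc x <= p -> normc (x ^+ n) <= p ^+ n.
Proof.
move=> H; rewrite normcX lerXn2r ?nnegrE ?normc_ge0//.
exact: le_trans (normc_ge0 _) H.
Qed.

Lemma normc_near1 (x : R[i]) : normc (x - 1) <= 2^-1 -> 2^-1 <= normc x <= 2.
Proof.
move=> H; have := normcD_le (x - 1) 1; have := normcB_ge 1 (1 - x).
rewrite subrK subKr -(normcN_eq (1 - x)) opprB ComplexField.Normc.normc1.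
by move=> ? ?; apply/andP; split; lra.
Qed.

(** Trades the square root in the modulus for a factor 1/2, which makes the logarithm of the modulus
    easy to differentiate. The case z = 0 is covered by the convention ln 0 = 0. *)
Lemma ln_normc z :
  ln (normc z) = 2^-1 * ln (complex.Re z ^+ 2 + complex.Im z ^+ 2).
Proof.
rewrite -normc_sqr; have [->|z0] := eqVneq z 0.
  by rewrite ComplexField.Normc.normc0 expr0n/= ln0// mulr0.
by rewrite lnXn ?normc_gt0// -(mulr_natl (ln _)) mulrA mulVf ?mul1r ?pnatr_eq0.
Qed.

End ComplexNorm.

(** * Complex-valued functions of a real variable, differentiated componentwise so that real
    calculus applies *)

Definition cderiv (R : realType) (f : R -> R[i]) (r : R) (d : R[i]) : Prop :=
  is_derive r 1 (fun x => complex.Re (f x)) (complex.Re d) /\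
  is_derive r 1 (fun x => complex.Im (f x)) (complex.Im d).

Section ComplexDerivative.
Context {R : realType}.
Implicit Types (f g : R -> R[i]) (r : R) (a b : R[i]).

Lemma is_derive_mul (f g : R -> R) (r a b : R) :
  is_derive r 1 f a -> is_derive r 1 g b ->
  is_derive r 1 (fun x => f x * g x) (a * g r + f r * b).
Proof.
move=> fa gb; apply: (is_derive_eq (is_deriveM fa gb)).
by rewrite /GRing.scale/= addrC (mulrC a).
Qed.

Lemma is_derive_add (f g : R -> R) (r a b : R) :
  is_derive r 1 f a -> is_derive r 1 g b -> is_derive r 1 (fun x => f x + g x) (a + b).
Proof. exact: is_deriveD. Qed.

Lemma is_derive_sub (f g : R -> R) (r a b : R) :
  is_derive r 1 f a -> is_derive r 1 g b -> is_derive r 1 (fun x => f x - g x) (a - b).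
Proof. exact: is_deriveB. Qed.

Lemma is_derive_scale (k : R) (f : R -> R) (r a : R) :
  is_derive r 1 f a -> is_derive r 1 (fun x => k * f x) (k * a).
Proof. exact: is_deriveZ. Qed.

Lemma cderiv_eq f r a b : cderiv f r a -> a = b -> cderiv f r b.
Proof. by move=> ? <-. Qed.

Lemma cderiv_cst c r : cderiv (fun=> c) r 0.
Proof. by split; apply: is_derive_cst. Qed.

Lemma cderiv_real r : cderiv (fun x => (x%:C)%C) r 1.
Proof. by split => /=; [apply: is_derive_id|apply: is_derive_cst]. Qed.

Lemma cderivD f g r a b : cderiv f r a -> cderiv g r b ->
  cderiv (fun x => f x + g x) r (a + b).
Proof.
move=> [f1 f2] [g1 g2]; split.
- have -> : (fun x => complex.Re (f x + g x)) =
    (fun x => complex.Re (f x)) + (fun x => complex.Re (g x)).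
    by apply/funext => x; rewrite raddfD.
  by rewrite cReD; exact: is_deriveD.
- have -> : (fun x => complex.Im (f x + g x)) =
    (fun x => complex.Im (f x)) + (fun x => complex.Im (g x)).
    by apply/funext => x; rewrite raddfD.
  by rewrite cImD; exact: is_deriveD.
Qed.

Lemma cderivM f g r a b : cderiv f r a -> cderiv g r b ->
  cderiv (fun x => f x * g x) r (a * g r + f r * b).
Proof.
move=> [f1 f2] [g1 g2].
split.
- have -> : (fun x => complex.Re (f x * g x)) =
    (fun x => complex.Re (f x) * complex.Re (g x))
    - (fun x => complex.Im (f x) * complex.Im (g x)).
    by apply/funext => x; rewrite cReM.
  apply: (is_derive_eq (is_deriveB (is_derive_mul f1 g1) (is_derive_mul f2 g2))).
  by rewrite cReD !cReM; ring.
- have -> : (fun x => complex.Im (f x * g x)) =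
    (fun x => complex.Re (f x) * complex.Im (g x))
    + (fun x => complex.Im (f x) * complex.Re (g x)).
    by apply/funext => x; rewrite cImM.
  apply: (is_derive_eq (is_deriveD (is_derive_mul f1 g2) (is_derive_mul f2 g1))).
  by rewrite cImD !cImM; ring.
Qed.

Lemma cderivN f r a : cderiv f r a -> cderiv (fun x => - f x) r (- a).
Proof.
move=> fa; have := cderivM (cderiv_cst (-1) r) fa.
rewrite mul0r add0r mulN1r; congr (cderiv _ _ _).
by apply/funext => x; rewrite mulN1r.
Qed.

Lemma cderivB f g r a b : cderiv f r a -> cderiv g r b ->
  cderiv (fun x => f x - g x) r (a - b).
Proof. by move=> fa gb; apply: cderivD => //; apply: cderivN. Qed.

Lemma cderivX f r a n : cderiv f r a ->
  cderiv (fun x => f x ^+ n) r (n%:R * f r ^+ n.-1 * a).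
Proof.
move=> fa; elim: n => [|n IH]; first by rewrite !mul0r; apply: cderiv_cst.
under eq_fun do rewrite exprS.
apply: cderiv_eq (cderivM fa IH) _ => /=; case: n {IH} => [|n] /=.
  by rewrite expr0; ring.
by rewrite exprS -[n.+2%:R]natr1; ring.
Qed.

Lemma cderiv_horner f r a (p : {poly R[i]}) : cderiv f r a ->
  cderiv (fun x => p.[f x]) r (p^`().[f r] * a).
Proof.
move=> fa; elim/poly_ind: p => [|p c IH].
  under eq_fun do rewrite horner0.
  by rewrite deriv0 horner0 mul0r; apply: cderiv_cst.
under eq_fun do rewrite hornerMXaddC.
apply: cderiv_eq (cderivD (cderivM IH fa) (cderiv_cst c r)) _.
by rewrite derivMXaddC !hornerE; ring.
Qed.

Let is_derive_norm2 f r a : cderiv f r a ->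
  is_derive r 1 (fun x => complex.Re (f x) ^+ 2 + complex.Im (f x) ^+ 2)
    (2 * (complex.Re (f r) * complex.Re a + complex.Im (f r) * complex.Im a)).
Proof.
move=> [f1 f2].
have -> : (fun x => complex.Re (f x) ^+ 2 + complex.Im (f x) ^+ 2) =
    (fun x => complex.Re (f x) * complex.Re (f x)) +
    (fun x => complex.Im (f x) * complex.Im (f x)).
  by apply/funext => x; rewrite !expr2.
apply: (is_derive_eq (is_deriveD (is_derive_mul f1 f1) (is_derive_mul f2 f2))).
by ring.
Qed.

Let norm2_gt0 (z : R[i]) : z != 0 -> 0 < complex.Re z ^+ 2 + complex.Im z ^+ 2.
Proof. by move=> z0; rewrite -normc_sqr exprn_gt0// normc_gt0. Qed.

(** The logarithm of the modulus is the real part of any local logarithm of [f], so its derivative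
    is the real part of the logarithmic derivative; no branch has to be chosen. *)
Lemma cderiv_ln_normc f r a : cderiv f r a -> f r != 0 ->
  is_derive r 1 (fun x => ln (normc (f x))) (complex.Re (a / f r)).
Proof.
move=> fa /norm2_gt0 f0; under eq_fun do rewrite ln_normc.
have H := @is_derive1_comp _ (@ln R) _ _ _ _ (is_derive1_ln f0 :
  is_derive ((fun x => complex.Re (f x) ^+ 2 + complex.Im (f x) ^+ 2) r) 1 _ _)
  (is_derive_norm2 fa).
apply: (is_derive_eq (is_deriveZ (2^-1 : R) H)).
move: f0; case: (f r) => x y /= n0; case: a {fa H} => a b /=.
by rewrite /GRing.scale /=; field; rewrite lt0r_neq0.
Qed.

Lemma cderivV f r a : cderiv f r a -> f r != 0 ->
  cderiv (fun x => (f x)^-1) r (- a / f r ^+ 2).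
Proof.
move=> fa /norm2_gt0 f0.
have H := @is_deriveV _ (fun x => complex.Re (f x) ^+ 2 + complex.Im (f x) ^+ 2)
  _ _ _ (lt0r_neq0 f0) (is_derive_norm2 fa).
have [f1 f2] := fa.
have ReV (z : R[i]) : complex.Re z^-1 =
    complex.Re z * (complex.Re z ^+ 2 + complex.Im z ^+ 2)^-1 by case: z.
have ImV (z : R[i]) : complex.Im z^-1 =
    - (complex.Im z * (complex.Re z ^+ 2 + complex.Im z ^+ 2)^-1) by case: z.
split.
- under eq_fun do rewrite ReV.
  apply: (is_derive_eq (is_derive_mul f1 H)).
  move: f0; case: (f r) => x y /= n0; case: a {fa H f1 f2} => a b /=.
  rewrite /GRing.scale /=.
  (* [field] meets the squared modulus of [f r ^+ 2] in components; it is the square of the squared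
     modulus of [f r], hence nonzero. *)
  have /lt0r_neq0 n1 : 0 < (x * x - y * y) ^+ 2 + (x * y + y * x) ^+ 2.
    suff -> : (x * x - y * y) ^+ 2 + (x * y + y * x) ^+ 2 = (x ^+ 2 + y ^+ 2) ^+ 2.
      by rewrite exprn_gt0.
    by ring.
  by field; rewrite n1 lt0r_neq0.
- under eq_fun do rewrite ImV.
  apply: (is_derive_eq (is_deriveN (is_derive_mul f2 H))).
  move: f0; case: (f r) => x y /= n0; case: a {fa H f1 f2} => a b /=.
  rewrite /GRing.scale /=.
  have /lt0r_neq0 n1 : 0 < (x * x - y * y) ^+ 2 + (x * y + y * x) ^+ 2.
    suff -> : (x * x - y * y) ^+ 2 + (x * y + y * x) ^+ 2 = (x ^+ 2 + y ^+ 2) ^+ 2.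
      by rewrite exprn_gt0.
    by ring.
  by field; rewrite n1 lt0r_neq0.
Qed.

Lemma cderiv_div f g r a b : cderiv f r a -> cderiv g r b -> g r != 0 ->
  cderiv (fun x => f x / g x) r ((a * g r - f r * b) / g r ^+ 2).
Proof.
move=> fa gb g0; apply: cderiv_eq (cderivM fa (cderivV gb g0)) _.
by field.
Qed.

Lemma mean_value_le (f f' : R -> R) (b M : R) : 0 <= b ->
  (forall r : R, 0 <= r <= b -> is_derive r 1 f (f' r)) ->
  (forall r, 0 < r < b -> `|f' r| <= M) -> `|f b - f 0| <= M * b.
Proof.
move=> b0 fd fM; have [->|bn0] := eqVneq b 0; first by rewrite subrr normr0 mulr0.
have bp : 0 < b by rewrite lt_def bn0.
have [x xb||c cb ->] := @MVT _ f f' 0 b bp.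
- by apply: fd; move: xb; rewrite in_itv/= => /andP[/ltW -> /ltW ->].
- apply: derivable_within_continuous => x; rewrite in_itv/= => xb.
  by have [] := fd _ xb.
rewrite subr0 normrM (ger0_norm b0) ler_wpM2r// fM//.
Qed.

(** The mean value theorem is real and is applied to the real and the imaginary part separately,
    which costs the factor 2. *)
Lemma cderiv_mean_value_le f f' (b M : R) : 0 <= b ->
  (forall r, 0 <= r <= b -> cderiv f r (f' r)) ->
  (forall r, 0 < r < b -> normc (f' r) <= M) ->
  normc (f b - f 0) <= 2 * M * b.
Proof.
move=> b0 fd fM.
apply: le_trans (normc_le_ReIm _) _.
rewrite -mulrA mulr_natl mulr2n !raddfB /=; apply: lerD.
- apply: (@mean_value_le (fun x => complex.Re (f x)) (fun x => complex.Re (f' x)))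
    => // r rb; first by have [] := fd _ rb.
  exact/le_trans/fM/rb/ler_Re_normc.
- apply: (@mean_value_le (fun x => complex.Im (f x)) (fun x => complex.Im (f' x)))
    => // r rb; first by have [] := fd _ rb.
  exact/le_trans/fM/rb/ler_Im_normc.
Qed.

End ComplexDerivative.

(** * Truncated logarithm series with a geometric error bound *)

Section LogSeries.
Context {R : realType}.
Implicit Types z : R[i].

(** Truncation of the series of - log (1 - z). The coefficient at n = 0 is zero because 0^-1 = 0. *)
Definition log_poly (N : nat) : {poly R[i]} := \poly_(n < N) (n%:R)^-1.

Lemma log_poly_deriv N z : (1 - z) * (log_poly N.+1)^`().[z] = 1 - z ^+ N.
Proof.
have -> : (log_poly N.+1)^`() = \poly_(n < N) 1.
  apply/polyP => i; rewrite coef_deriv /log_poly !coef_poly ltnS.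
  by case: ltnP => _; rewrite ?mul0rn// -[LHS]mulr_natr mulVf// pnatr_eq0.
rewrite horner_poly -opprB mulNr -[RHS]opprB; congr (- _).
rewrite [in RHS]subrX1; congr (_ * _).
by apply: eq_bigr => i _; rewrite mul1r.
Qed.

(** The error vanishes at 0. Along the segment r z its derivative collapses, by the geometric sum,
    to the real part of - (r z)^N z / (1 - r z), of modulus at most 2^-N times 1 times 2. *)
Lemma ln_normc_approx N z : normc z <= 2^-1 ->
  `|ln (normc (1 - z)) + complex.Re (log_poly N.+1).[z]| <= 2 * 2^-1 ^+ N.
Proof.
move=> z2.
pose f (r : R) := (r%:C * z)%C : R[i].
have f' r : cderiv f r z.
  by apply: cderiv_eq (cderivM (cderiv_real r) (cderiv_cst z r)) _; ring.
pose g (r : R) := 1 - f r.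
have nf (r : R) : 0 <= r <= 1 -> normc (f r) <= 2^-1.
  move=> /andP[r0 r1]; rewrite ComplexField.Normc.normcM normc_real ger0_norm//.
  by apply: le_trans z2; rewrite ler_piMl// normc_ge0.
have ng (r : R) : 0 <= r <= 1 -> 2^-1 <= normc (g r).
  move=> /nf H; have := normcB_ge 1 (f r).
  by rewrite ComplexField.Normc.normc1 /g; lra.
have gn0 (r : R) : 0 <= r <= 1 -> g r != 0.
  by move=> /ng H; rewrite -normc_gt0; apply: lt_le_trans H; rewrite invr_gt0.
have g' r : cderiv g r (- z).
  by apply: cderiv_eq (cderivB (cderiv_cst 1 r) (f' r)) _; rewrite sub0r.
pose h r := ln (normc (g r)) + complex.Re (log_poly N.+1).[f r].
have h' (r : R) : 0 <= r <= 1 -> is_derive r 1 h (complex.Re (- f r ^+ N * z / g r)).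
  move=> r01; have [H _] := cderiv_horner (log_poly N.+1) (f' r).
  apply: (is_derive_eq (is_deriveD (cderiv_ln_normc (g' r) (gn0 _ r01)) H)).
  rewrite -cReD; congr complex.Re.
  apply: (mulIf (gn0 _ r01)); rewrite mulrDl !divfK ?gn0//.
  rewrite -mulrA (mulrC z) mulrA (mulrC _ (g r)) log_poly_deriv; ring.
have h0 : h 0 = 0.
  rewrite /h /g /f mul0r subr0 ComplexField.Normc.normc1 ln1 add0r.
  by rewrite horner_coef0 coef_poly ltn0Sn mulr0n invr0.
have -> : ln (normc (1 - z)) + complex.Re (log_poly N.+1).[z] = h 1 - h 0.
  by rewrite h0 subr0 /h /g /f mul1r.
rewrite -[leRHS]mulr1.
apply: (mean_value_le ler01 h') => c /andP[/ltW c0 /ltW c1].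
have cb : 0 <= c <= 1 by rewrite c0 c1.
apply: le_trans (ler_Re_normc _) _.
rewrite !ComplexField.Normc.normcM normcN_eq normcX ComplexField.Normc.normcV.
have f2 : normc (f c) ^+ N <= 2^-1 ^+ N.
  by rewrite lerXn2r ?nnegrE ?normc_ge0// ?invr_ge0// nf.
have g2 : (normc (g c))^-1 <= 2.
  by rewrite -[2]invrK lef_pV2 ?posrE ?ng// normc_gt0 gn0.
have z1 : normc z <= 1 by lra.
rewrite (mulrC 2); apply: ler_pM => //; rewrite ?mulr_ge0 ?invr_ge0 ?normc_ge0 ?exprn_ge0 ?normc_ge0//.
by rewrite -[leRHS]mulr1 ler_pM ?exprn_ge0 ?normc_ge0.
Qed.

End LogSeries.

(** * Integration over the unit interval and uniform limits *)

Section Integrals.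
Context {R : realType}.
Notation mu := (@lebesgue_measure R).
Notation I01 := (`[0%R, 1%R]%classic : set R).

Definition int01 (f : R -> R) : R := Rintegral mu `[0%R, 1%R] f.

Let measurable_I01 : measurable (I01 : set (measurableTypeR R)).
Proof. exact: measurable_itv. Qed.

Lemma derivable_integrable01 (f : R -> R) : (forall x : R, derivable f x 1) ->
  mu.-integrable I01 (EFin \o f).
Proof.
move=> df; apply: continuous_compact_integrable; first exact: segment_compact.
by apply: derivable_within_continuous => x _; apply: df.
Qed.

Lemma int01_antiderivative (F f : R -> R) : (forall x : R, is_derive x 1 F (f x)) ->
  (forall x : R, derivable f x 1) -> int01 f = F 1 - F 0.
Proof.
move=> Ff df; rewrite /int01 /Rintegral (@continuous_FTC2 _ f F)//.
- by apply: derivable_within_continuous => x _; apply: df.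
- have cF : forall x, {for x, continuous F}.
    by move=> x; apply/differentiable_continuous/derivable1_diffP; have [] := Ff x.
  split.
  + by move=> x _; have [] := Ff x.
  + exact/cvg_at_right_filter/cF.
  + exact/cvg_at_left_filter/cF.
- by move=> x _; rewrite derive1E; have [] := Ff x.
Qed.

Lemma int01_dist (f g : R -> R) (e : R) :
  mu.-integrable I01 (EFin \o f) -> mu.-integrable I01 (EFin \o g) ->
  (forall x, `|f x - g x| <= e) -> `|int01 f - int01 g| <= e.
Proof.
move=> fi gi fg; rewrite /int01 -RintegralB//.
have fgi : mu.-integrable I01 (EFin \o (fun x => f x - g x)).
  by have := integrableB measurable_I01 fi gi; apply: eq_integrable.
apply: le_trans (le_normr_Rintegral measurable_I01 fgi) _.
have -> : e = Rintegral mu I01 (fun=> e).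
  by rewrite Rintegral_cst//= lebesgue_measure_itv/= lte_fin ltr01 sube0/= mulr1.
apply: le_Rintegral => //.
  by have := integrable_norm fgi; apply: eq_integrable.
by apply: derivable_integrable01 => x; apply: derivable_cst.
Qed.

(** [f] is measurable as a pointwise limit of continuous functions and integrable because |g 0| + C
    dominates it. This serves for the inner Mahler integral as a function of the outer angle, which
    is known only through its approximations. *)
Lemma int01_uniform_limit (f : R -> R) (g : nat -> R -> R) (C : R) :
  (forall N (x : R), derivable (g N) x 1) ->
  (forall N x, `|f x - g N x| <= C * 2^-1 ^+ N) ->
  forall N, `|int01 f - int01 (g N)| <= C * 2^-1 ^+ N.
Proof.
move=> dg fg.
have mf : measurable_fun (I01 : set (measurableTypeR R)) (f : _ -> measurableTypeR R).
  apply: (measurable_realfun.measurable_fun_cvg (h := g)).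
    move=> m; apply: measurable_funTS.
    apply: measurable_realfun.continuous_measurable_fun => x.
    exact/differentiable_continuous/derivable1_diffP.
  move=> x _; apply/cvgrPdist_le => e e0.
  have : (C * (2^-1 : R) ^+ N @[N --> \oo] --> C * 0)%classic.
    apply: cvgMl_tmp; apply: cvg_expr.
    by rewrite ger0_norm ?invr_ge0// invf_lt1 ?ltr1n.
  rewrite mulr0 => /cvgrPdist_le/(_ e e0); apply: filterS => N.
  rewrite sub0r normrN => H; apply: le_trans (fg N x) _.
  by apply: le_trans H; apply: ler_norm.
have fi : mu.-integrable I01 (EFin \o f).
  have cC : mu.-integrable I01 (EFin \o (fun=> C)).
    by apply: derivable_integrable01 => x; apply: derivable_cst.
  have := integrableD measurable_I01
    (integrable_norm (derivable_integrable01 (dg 0%N))) cC.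
  apply: le_integrable => //; first exact/measurable_realfun.measurable_EFinP.
  move=> x _; rewrite /= lee_fin.
  have := fg 0%N x; rewrite expr0 mulr1 => H.
  apply: le_trans (ler_norm _).
  by rewrite -lerBlDl; apply: le_trans H; rewrite lerB_dist.
move=> N; apply: int01_dist => //.
exact: derivable_integrable01.
Qed.

End Integrals.

(** * Complex integrals by antiderivatives, and characters of the circle *)

Section ComplexIntegral.
Context {R : realType}.
Implicit Types (f F : R -> R[i]).

(** [I] is the integral over [0, 1], witnessed by an antiderivative. The differentiability clause
    supplies the continuity that the fundamental theorem of calculus asks for. *)
Definition has_cint f (I : R[i]) : Prop :=
  (forall x, exists d, cderiv f x d) /\
  exists2 F, (forall x, cderiv F x (f x)) & F 1 - F 0 = I.

Lemma has_cint_Re f I : has_cint f I ->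
  int01 (fun x => complex.Re (f x)) = complex.Re I.
Proof.
move=> [df [F Ff <-]].
rewrite raddfB; apply: (@int01_antiderivative _ (fun x => complex.Re (F x))).
- by move=> x; have [] := Ff x.
- by move=> x; have [d [[]]] := df x.
Qed.

Lemma has_cint0 : has_cint (fun=> 0) 0.
Proof.
split=> [x|]; first by exists 0; apply: cderiv_cst.
by exists (fun=> 0); [move=> x; apply: cderiv_cst|rewrite subr0].
Qed.

Lemma has_cintD f g I J : has_cint f I -> has_cint g J ->
  has_cint (fun x => f x + g x) (I + J).
Proof.
move=> [df [F Ff <-]] [dg [G Gg <-]]; split=> [x|].
  by have [a fa] := df x; have [b gb] := dg x; exists (a + b); apply: cderivD.
exists (fun x => F x + G x); first by move=> x; apply: cderivD.
by rewrite opprD addrACA.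
Qed.

Lemma has_cintZ c f I : has_cint f I -> has_cint (fun x => c * f x) (c * I).
Proof.
move=> [df [F Ff <-]]; split=> [x|].
  by have [a fa] := df x; eexists; apply: cderivM fa; apply: cderiv_cst.
exists (fun x => c * F x); last by rewrite mulrBr.
by move=> x; apply: cderiv_eq (cderivM (cderiv_cst c x) (Ff x)) _; rewrite mul0r add0r.
Qed.

Lemma has_cint_sum (T : Type) (s : seq T) (P : pred T) (f : T -> R -> R[i])
    (I : T -> R[i]) : (forall i, has_cint (f i) (I i)) ->
  has_cint (fun x => \sum_(i <- s | P i) f i x) (\sum_(i <- s | P i) I i).
Proof.
move=> fI; elim: s => [|i s IH].
  by under eq_fun do rewrite big_nil; rewrite big_nil; apply: has_cint0.
under eq_fun do rewrite big_cons; rewrite big_cons.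
by case: (P i) => //; apply: has_cintD.
Qed.

Lemma expi2pi0 : expi2pi (0 : R) = 1.
Proof. by rewrite /expi2pi mulr0 cos0 sin0. Qed.

Lemma expi2piD (a b : R) : expi2pi (a + b) = expi2pi a * expi2pi b.
Proof. by rewrite /expi2pi mulrDr cosD sinD; congr Complex; rewrite addrC. Qed.

Lemma expi2piN (a : R) : expi2pi a * expi2pi (- a) = 1.
Proof. by rewrite -expi2piD subrr expi2pi0. Qed.

Lemma expi2piX (a : R) n : expi2pi a ^+ n = expi2pi (n%:R * a).
Proof.
elim: n => [|n IH]; first by rewrite mul0r expi2pi0.
by rewrite exprS IH -expi2piD -natr1; congr expi2pi; ring.
Qed.

Lemma expi2pi1 : expi2pi (1 : R) = 1.
Proof. by rewrite /expi2pi mulr1 mulr_natl cos2pi sin2pi. Qed.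

Lemma expi2pi_int (m : int) : expi2pi (m%:~R : R) = 1.
Proof.
have En n : expi2pi (n%:R : R) = 1.
  by rewrite -[n%:R]mulr1 -expi2piX expi2pi1 expr1n.
case: m => n; first exact: En.
by rewrite NegzE mulrNz; have := expi2piN (n.+1%:R); rewrite En mul1r.
Qed.

Lemma normc_expi2pi (a : R) : normc (expi2pi a) = 1.
Proof. by rewrite normcE2 /= cos2Dsin2 sqrtr1. Qed.

Lemma expi2pi_neq0 (a : R) : expi2pi a != 0.
Proof. by rewrite -normc_gt0 normc_expi2pi. Qed.

Lemma cderiv_expi2pi (b c x : R) :
  cderiv (fun x => expi2pi (b * x + c)) x
    (Complex 0 (2 * pi * b) * expi2pi (b * x + c)).
Proof.
have lin : is_derive x 1 (fun y : R => 2 * pi * (b * y + c)) (2 * pi * b).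
  have -> : (fun y : R => 2 * pi * (b * y + c)) =
      (fun y : R => (2 * pi * b) * y) + (cst (2 * pi * c)).
    apply/funext => y.
    by change (2 * pi * (b * y + c) = 2 * pi * b * y + 2 * pi * c); ring.
  apply: (is_derive_eq (is_deriveD
    (is_derive_mul (is_derive_cst (2 * pi * b) x 1) (is_derive_id x 1))
    (is_derive_cst _ x 1))).
  by rewrite /cst/=; ring.
split.
- apply: (is_derive_eq (@is_derive1_comp _ cos (fun y => 2 * pi * (b * y + c))
    _ _ _ (is_derive_cos _) lin)).
  by rewrite cReM /=; ring.
- apply: (is_derive_eq (@is_derive1_comp _ sin (fun y => 2 * pi * (b * y + c))
    _ _ _ (is_derive_sin _) lin)).
  by rewrite cImM /=; ring.
Qed.

(** Orthogonality of characters: for nonzero m the antiderivative exp(2 pi i m x) / (2 pi i m) takes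
    the same value at 0 and at 1. *)
Lemma has_cint_expi2pi (m : int) :
  has_cint (fun x => expi2pi (m%:~R * x)) (m == 0)%:R.
Proof.
have dE (b x : R) : cderiv (fun x => expi2pi (b * x)) x
    (Complex 0 (2 * pi * b) * expi2pi (b * x)).
  have := cderiv_expi2pi b 0 x; rewrite addr0.
  by under eq_fun do rewrite addr0.
split=> [x|]; first by eexists; apply: dE.
have [->|m0] := eqVneq m 0.
  exists (fun x => (x%:C)%C); last by rewrite subr0.
  by move=> x; rewrite mul0r expi2pi0; apply: cderiv_real.
have c0 : Complex 0 (2 * pi * m%:~R) != 0 :> R[i].
  rewrite eq_complex /= eqxx /= !mulf_neq0 ?intr_eq0//.
  by rewrite lt0r_neq0// pi_gt0.
exists (fun x => (Complex 0 (2 * pi * m%:~R))^-1 * expi2pi (m%:~R * x)).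
  move=> x; apply: cderiv_eq (cderivM (cderiv_cst _ x) (dE _ x)) _.
  by rewrite mul0r add0r mulrA mulVf// mul1r.
by rewrite mulr1 mulr0 expi2pi0 expi2pi_int subrr.
Qed.

End ComplexIntegral.

(** * Constant terms of powers of the Hesse Laurent polynomial *)

Section ConstantTerm.
Context {R : realType}.

(** The Laurent polynomial x^2/y + y^2/x + 1/(x y) at the torus point with angles a and b. *)
Definition hesse_laurent (a b : R) : R[i] :=
  expi2pi (2 * a - b) + (expi2pi (2 * b - a) + expi2pi (- a - b)).

(* The constant term of (x^2/y + y^2/x + 1/(xy))^n. *)
Definition hesse_const_term (n : nat) : nat :=
  (\sum_(i < n.+1) \sum_(j < i.+1)
    ((2 * n == 3 * i) && (3 * i == 3 * j + n)) * ('C(n, i) * 'C(i, j)))%N.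

(** The trinomial number (3m)! / m!^3, written without division. *)
Definition hesse_coef (m : nat) : nat := ('C(3 * m, m) * 'C(2 * m, m))%N.

(** Both exponents vanish only if each of the three monomials is chosen m times, that is for i = 2m
    and j = m; one term survives. *)
Lemma hesse_const_term3 m : hesse_const_term (3 * m) = hesse_coef m.
Proof.
have im : (2 * m < (3 * m).+1)%N by lia.
have jm : (m < (2 * m).+1)%N by lia.
rewrite /hesse_const_term (bigD1 (Ordinal im))//= [X in (_ + X)%N]big1 ?addn0.
  rewrite (bigD1 (Ordinal jm))//= [X in (_ + X)%N]big1 ?addn0.
    have -> : (2 * (3 * m) == 3 * (2 * m))%N && (3 * (2 * m) == 3 * m + 3 * m)%N.
      by lia.
    have -> : (2 * m = 3 * m - m)%N by lia.
    by rewrite mul1n /hesse_coef bin_sub ?leq_pmull//; congr (_ * 'C(_, _))%N; lia.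
  move=> j; rewrite -val_eqE /= => jn.
  by case: andP => [[]|]; rewrite ?mul0n//; lia.
move=> i; rewrite -val_eqE /= => jn; apply: big1 => j _.
by case: andP => [[]|]; rewrite ?mul0n//; lia.
Qed.

Lemma hesse_const_term_eq0 n : ~~ (3 %| n)%N -> hesse_const_term n = 0%N.
Proof.
move=> n3; rewrite /hesse_const_term big1// => i _; apply: big1 => j _.
by case: andP => [[]|]; rewrite ?mul0n//; lia.
Qed.

(** Two nested binomial expansions: n - i, i - j and j count the factors x^2/y, y^2/x and 1/(x y),
    which gives the exponents 2n - 3i of x and 3i - 3j - n of y. *)
Lemma hesse_laurentX (a b : R) n : hesse_laurent a b ^+ n =
  \sum_(i < n.+1) \sum_(j < i.+1) (('C(n, i) * 'C(i, j))%:R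
    * (expi2pi ((2 * n%:Z - 3 * i%:Z)%:~R * a)
    * expi2pi ((3 * i%:Z - 3 * j%:Z - n%:Z)%:~R * b))).
Proof.
rewrite /hesse_laurent exprDn; apply: eq_bigr => i _.
rewrite exprDn mulr_sumr -sumrMnl; apply: eq_bigr => j _.
rewrite mulrnAr -mulrnA mulnC -[LHS]mulr_natl; congr (_ * _).
rewrite !expi2piX -!expi2piD; congr expi2pi.
have ni : (i <= n)%N by rewrite -ltnS.
have ij : (j <= i)%N by rewrite -ltnS.
by rewrite !natrB//; ring.
Qed.

(** The result of integrating over the second angle: the boolean factor keeps the monomials of
    degree 0 in y. *)
Definition inner_mean (c : nat -> R[i]) N (a : R) : R[i] :=
  \sum_(n < N) c n * \sum_(i < n.+1) \sum_(j < i.+1)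
   (('C(n, i) * 'C(i, j))%:R * (3 * i%:Z - 3 * j%:Z - n%:Z == 0)%:R)
   * expi2pi ((2 * n%:Z - 3 * i%:Z)%:~R * a).

Lemma has_cint_inner (c : nat -> R[i]) N (a : R) :
  has_cint (fun b => \sum_(n < N) c n * hesse_laurent a b ^+ n) (inner_mean c N a).
Proof.
apply: has_cint_sum => n; apply: has_cintZ.
under eq_fun do rewrite hesse_laurentX.
apply: has_cint_sum => i; apply: has_cint_sum => j.
rewrite mulrAC; under eq_fun do rewrite mulrA.
exact/has_cintZ/has_cint_expi2pi.
Qed.

Lemma has_cint_outer (c : nat -> R[i]) N : has_cint (inner_mean c N)
  (\sum_(n < N) c n * (hesse_const_term n)%:R).
Proof.
apply: has_cint_sum => n; apply: has_cintZ.
rewrite /hesse_const_term natr_sum; apply: has_cint_sum => i.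
rewrite natr_sum; apply: has_cint_sum => j.
have -> : (((2 * n == 3 * i) && (3 * i == 3 * j + n)) * ('C(n, i) * 'C(i, j)))%N%:R =
  (('C(n, i) * 'C(i, j))%:R * (3 * i%:Z - 3 * j%:Z - n%:Z == 0)%:R)
   * (2 * n%:Z - 3 * i%:Z == 0)%:R :> R[i].
  rewrite -!natrM; congr _%:R.
  rewrite -[RHS]mulnA mulnb mulnC andbC; congr (_ * nat_of_bool (_ && _))%N.
    by apply/eqP/eqP; lia.
  by apply/eqP/eqP; lia.
exact/has_cintZ/has_cint_expi2pi.
Qed.

End ConstantTerm.

(** * Series approximation of the Mahler measure of the Hesse family *)

Section HesseMahler.
Context {R : realType}.
Implicit Types (a b : R) (s w k : R[i]).

Lemma has_cint_cst (c : R[i]) : has_cint (fun=> c) c.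
Proof.
split=> [x|]; first by exists 0; apply: cderiv_cst.
exists (fun x => c * (x%:C)%C); last by rewrite mulr1 mulr0 subr0.
move=> x; apply: cderiv_eq (cderivM (cderiv_cst c x) (cderiv_real x)) _.
by rewrite mul0r add0r mulr1.
Qed.

Lemma hesseP_factor k a b : k != 0 ->
  hesseP k (expi2pi a) (expi2pi b) =
  - (k * expi2pi a * expi2pi b) * (1 - k^-1 * hesse_laurent a b).
Proof.
move=> k0; have a0 := expi2pi_neq0 a; have b0 := expi2pi_neq0 b.
have EN c : expi2pi (- c : R) = (expi2pi c)^-1.
  by apply: (mulfI (expi2pi_neq0 c)); rewrite expi2piN divff ?expi2pi_neq0.
rewrite /hesseP /hesse_laurent !expi2piD !EN -!expi2piX.
by field; rewrite k0 a0 b0.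
Qed.

Lemma normc_hesse_laurent a b : normc (hesse_laurent a b) <= 3.
Proof.
rewrite /hesse_laurent; apply: le_trans (normcD_le _ _) _.
have := normcD_le (expi2pi (2 * b - a)) (expi2pi (- a - b)).
by rewrite !normc_expi2pi; lra.
Qed.

(** The Laurent polynomial is at most 3 in modulus on the torus, so 1/6 keeps the argument of the
    logarithm series within radius 1/2. The uniform limit theorem is then used twice, for the inner
    integral and for the outer one, and leaves the constant terms. *)
Lemma mahler2_hesse_approx k N : k != 0 -> normc k^-1 <= 6^-1 ->
  `|mahler2 (hesseP k) - complex.Re ((ln (normc k))%:C%C -
     \sum_(n < N.+1) (n%:R^-1 * k^-1 ^+ n) * (hesse_const_term n)%:R)| <= 2 * 2^-1 ^+ N.
Proof.
move=> k0 k6.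
pose c n : R[i] := n%:R^-1 * k^-1 ^+ n.
pose K : R[i] := (ln (normc k))%:C%C.
have sub f I : has_cint f I -> has_cint (fun x : R => K - f x) (K - I).
  move=> fI; have := has_cintD (has_cint_cst K) (has_cintZ (-1) fI).
  by rewrite mulN1r; under eq_fun do rewrite mulN1r.
have der f I : has_cint f I -> forall x : R, derivable (fun y => complex.Re (f y)) x 1.
  by move=> [df _] x; have [d [[]]] := df x.
pose g a b := ln (normc (hesseP k (expi2pi a) (expi2pi b))).
have gE M a b : `|g a b - complex.Re (K - \sum_(n < M.+1) c n * hesse_laurent a b ^+ n)|
    <= 2 * 2^-1 ^+ M.
  have w2 : normc (k^-1 * hesse_laurent a b) <= 2^-1.
    rewrite ComplexField.Normc.normcM.
    have -> : 2^-1 = 6^-1 * 3 :> R by field.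
    by rewrite ler_pM ?normc_ge0 ?normc_hesse_laurent.
  have := ln_normc_approx M w2.
  have n0 : 1 - k^-1 * hesse_laurent a b != 0.
    rewrite -normc_gt0; have := normcB_ge 1 (k^-1 * hesse_laurent a b).
    by rewrite ComplexField.Normc.normc1; lra.
  rewrite /g hesseP_factor// ComplexField.Normc.normcM normcN_eq.
  rewrite !ComplexField.Normc.normcM !normc_expi2pi !mulr1 lnM ?posrE ?normc_gt0//.
  rewrite raddfB /= opprB addrCA addrAC subrr add0r [X in _ -> `|X| <= _]addrC.
  congr (is_true (`|_ + complex.Re _| <= _)).
  rewrite horner_poly; apply: eq_bigr => n _.
  by rewrite exprMn mulrA.
have inner M a : `|int01 (g a) - complex.Re (K - inner_mean c M.+1 a)| <= 2 * 2^-1 ^+ M.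
  have H L := sub _ _ (has_cint_inner c L.+1 a).
  rewrite -(has_cint_Re (H M)).
  apply: (@int01_uniform_limit _ (g a) (fun L b => complex.Re
     (K - \sum_(n < L.+1) c n * hesse_laurent a b ^+ n)) 2) => [L|L b].
    exact: der (H L).
  exact: gE.
have H L := sub _ _ (has_cint_outer c L.+1).
rewrite -(has_cint_Re (H N)).
apply: (@int01_uniform_limit _ (fun a => int01 (g a)) (fun L a => complex.Re
     (K - inner_mean c L.+1 a)) 2) => [L|L a].
  exact: der (H L).
exact: inner.
Qed.

(** The sum of a_m s^m / m without constant term: division by 0 gives 0 at m = 0. *)
Definition hesse_log (M : nat) : {poly R[i]} :=
  \poly_(m < M) ((hesse_coef m)%:R / m%:R).

Lemma hesse_const_term_sum s w M : w ^+ 3 = s ->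
  \sum_(n < 3 * M) (n%:R^-1 * w ^+ n) * (hesse_const_term n)%:R =
  3^-1 * (hesse_log M).[s].
Proof.
move=> <-; rewrite horner_poly mulr_sumr.
elim: M => [|M IH]; first by rewrite muln0 !big_ord0.
rewrite (_ : (3 * M.+1 = (3 * M).+3)%N); last by lia.
(* Of the three new indices 3M, 3M + 1 and 3M + 2, only the first has a nonzero constant term. *)
rewrite !big_ord_recr /= IH hesse_const_term3 !(@hesse_const_term_eq0 _.+1); [|lia|lia].
rewrite !mulr0 !addr0; congr (_ + _).
by rewrite natrM invfM exprM; ring.
Qed.

(** With k^-3 = s the bound 216^-1 = 6^-3 is the condition on k. Only powers of k^-3 and the modulus
    of k survive, so the chosen cube root drops out. *)
Lemma nfun_approx s M : s != 0 -> normc s <= 216^-1 ->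
  `|nfun (27 * s) + 3^-1 * (ln (normc s) + complex.Re (hesse_log M.+1).[s])|
  <= 2 * 2^-1 ^+ M.
Proof.
move=> s0 s216; rewrite /nfun; set q := 3.-root _; set k := 3 / q.
have q3 : q ^+ 3 = 27 * s by rewrite /q rootCK.
have q0 : q != 0 by apply: contra_eqT q3 => /negbNE/eqP ->; rewrite expr0n eq_sym mulf_neq0// pnatr_eq0.
have k0 : k != 0 by rewrite mulf_neq0 ?invr_eq0// pnatr_eq0.
have w3 : k^-1 ^+ 3 = s.
  rewrite /k invf_div expr_div_n q3.
  by field.
have nk3 : normc k^-1 ^+ 3 = normc s by rewrite -normcX w3.
have k6 : normc k^-1 <= 6^-1.
  rewrite -(@ler_pXn2r _ 3)// ?nnegrE ?normc_ge0 ?invr_ge0// nk3.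
  by have -> : 6^-1 ^+ 3 = 216^-1 :> R by field.
have lnk : ln (normc k) = - (3^-1 * ln (normc s)).
  rewrite -nk3 ComplexField.Normc.normcV lnXn ?invr_gt0 ?normc_gt0//.
  by rewrite lnV ?posrE ?normc_gt0// -mulr_natl; field.
(* The order 3M + 2 makes the sum run over n < 3 (M + 1), a whole number of blocks of three. *)
have := mahler2_hesse_approx (3 * M).+2 k0 k6.
rewrite (_ : (3 * M).+3 = (3 * M.+1)%N); last by lia.
rewrite (hesse_const_term_sum _ w3) lnk raddfB /=.
have -> : complex.Re (3^-1 * (hesse_log M.+1).[s]) = 3^-1 * complex.Re (hesse_log M.+1).[s].
  rewrite -[3^-1](_ : (3^-1)%:C%C = _).
    by rewrite cReM /= mul0r subr0.
  by rewrite rmorphV ?unitfE ?pnatr_eq0// rmorph_nat.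
rewrite opprB opprK addrC (addrC (_ * complex.Re _)) -mulrDr addrC => H.
apply: le_trans H _; rewrite ler_pM2l//.
by apply: ler_wiXn2l; rewrite ?invr_ge0 ?invf_le1 ?ler1n//; lia.
Qed.

End HesseMahler.

(** * The hypergeometric coefficients, their truncated series and its equation *)

Section HesseSeries.
Context {R : realType}.
Implicit Types s : R[i].

Lemma hesse_coef_fact m : (hesse_coef m * m`! ^ 3 = (3 * m)`!)%N.
Proof.
rewrite -(@bin_fact (3 * m) m) ?leq_pmull// (_ : (3 * m - m = 2 * m)%N); last by lia.
rewrite -(@bin_fact (2 * m) m) ?leq_pmull// (_ : (2 * m - m = m)%N); last by lia.
by rewrite /hesse_coef; lia.
Qed.

Lemma hesse_coef_rec m :
  (m.+1 ^ 2 * hesse_coef m.+1 = 3 * (3 * m + 1) * (3 * m + 2) * hesse_coef m)%N.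
Proof.
have := hesse_coef_fact m.+1.
rewrite (_ : (3 * m.+1 = (3 * m).+3)%N); last by lia.
rewrite 3!factS factS -hesse_coef_fact expnMn => H.
(* The common factor to be cancelled from the relation between factorials; the extra m + 1 comes
   from 3m + 3. *)
have p : (0 < m.+1 * m`! ^ 3)%N by rewrite muln_gt0 expn_gt0 fact_gt0.
by apply/eqP; rewrite -(eqn_pmul2r p); apply/eqP; lia.
Qed.

Lemma hesse_coef_recr m : (m.+1 ^ 2 * hesse_coef m.+1)%:R =
  3 * (3 * m%:R + 1) * (3 * m%:R + 2) * (hesse_coef m)%:R :> R[i].
Proof. by rewrite hesse_coef_rec; ring. Qed.

(** By the recursion, consecutive coefficients have ratio at most 27, as 3 (3m + 1) (3m + 2) <= 27
    (m + 1)^2. *)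
Lemma hesse_coef_le m : (hesse_coef m <= 27 ^ m)%N.
Proof.
elim: m => [//|m IH].
have p : (0 < m.+1 ^ 2)%N by rewrite expn_gt0.
rewrite -(leq_pmul2l p) hesse_coef_rec (expnS 27).
apply: (@leq_trans (27 * m.+1 ^ 2 * hesse_coef m)).
  by rewrite leq_mul2r; apply/orP; right; nia.
by apply: (@leq_trans (27 * m.+1 ^ 2 * 27 ^ m)); [rewrite leq_mul2l IH orbT|lia].
Qed.

(* Truncation of 2F1(1/3, 2/3; 1; 27 s). *)
Definition hesse_poly (N : nat) : {poly R[i]} := \poly_(m < N.+1) (hesse_coef m)%:R.

(** What truncation takes away from the differential equation: the contribution of the absent
    a_(N+1), in degree N. *)
Definition hesse_defect N s : R[i] := (N.+1 ^ 2 * hesse_coef N.+1)%:R * s ^+ N.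

(** The hypergeometric equation in self-adjoint form, ((1 - 27 s) s A')' = 6 A, up to the defect. *)
Lemma hesse_poly_ode N s :
  (((1 - 27%:R *: 'X) * 'X * (hesse_poly N)^`())^`()).[s] =
  6 * (hesse_poly N).[s] - hesse_defect N s.
Proof.
have -> : ((1 - 27%:R *: 'X) * 'X * (hesse_poly N)^`())^`() =
    6%:R *: hesse_poly N - (N.+1 ^ 2 * hesse_coef N.+1)%:R *: 'X^N.
  apply/polyP => i.
  rewrite mulrBl mul1r -scalerAl mulrBl -scalerAl -mulrA.
  rewrite coef_deriv !coefB !coefZ coefXn coefXM [_.+1 == 0%N]/=.
  rewrite coefXM [_.+1 == 0%N]/= [_.+1.-1]/= coefXM !coef_deriv /hesse_poly !coef_poly.
  have -> : (if i == 0%N then 0 else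
      (if (i.-1.+1 < N.+1)%N then (hesse_coef i.-1.+1)%:R else 0) *+ i.-1.+1) =
      (if (i < N.+1)%N then (hesse_coef i)%:R else 0) *+ i :> R[i] by case: i.
  rewrite /= !ltnS -!(mulr_natr (if _ then _ else _)) -[LHS]mulr_natr.
  have := hesse_coef_recr i; rewrite natrM natrX -natr1 => E.
  (* In degrees below N this is the recursion, above N everything is zero, and degree N produces the
     defect. *)
  case: ltngtP => [iN|Ni|->] /=.
  - rewrite mulr0 subr0; apply: etrans (_ : (i%:R + 1) ^+ 2 * (hesse_coef i.+1)%:R
      - 27 * i%:R * (i%:R + 1) * (hesse_coef i)%:R = _); first by ring.
    by rewrite E; ring.
  - by ring.
  - by rewrite hesse_coef_recr; ring.
by rewrite hornerD hornerN !hornerZ hornerXn.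
Qed.

Lemma hesse_log_deriv N s :
  s * (hesse_log N.+1)^`().[s] = (hesse_poly N).[s] - 1.
Proof.
have -> : hesse_poly N = 'X * (hesse_log N.+1)^`() + 1.
  apply/polyP => i; rewrite coefD coef1 coefXM coef_deriv /hesse_log /hesse_poly !coef_poly.
  case: i => [|i] /=; first by rewrite add0r.
  by rewrite addr0 ltnS; case: ifP; rewrite ?mul0rn// => _; rewrite -[RHS]mulr_natr divfK// pnatr_eq0.
by rewrite !hornerE addrK.
Qed.

Lemma hesse_poly0 N : (hesse_poly N).[0] = 1 :> R[i].
Proof. by rewrite horner_coef0 coef_poly. Qed.

Lemma hesse_log0 N : (hesse_log N.+1).[0] = 0 :> R[i].
Proof. by rewrite horner_coef0 coef_poly /= mulr0n invr0 mulr0. Qed.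

Lemma hesse_poly_bound N s : normc s <= 216^-1 ->
  normc ((hesse_poly N).[s] - 1) <= 2^-1.
Proof.
move=> s216.
(* Since 27/216 = 1/8, the terms from m = 1 on are dominated by a geometric series; its exact
   partial sum makes the induction go through. *)
suff : normc ((hesse_poly N).[s] - 1) <= (1 - 8^-1 ^+ N) / 7.
  move=> /le_trans; apply; have : 0 <= (8^-1 : R) ^+ N by rewrite exprn_ge0 ?invr_ge0.
  by lra.
rewrite horner_poly; elim: N => [|N IH].
  by rewrite big_ord1 (_ : hesse_coef _ = 1%N)// expr0 mulr1 subrr ComplexField.Normc.normc0 subrr mul0r.
rewrite big_ord_recr /= addrAC; apply: le_trans (normcD_le _ _) _.
have H : normc ((hesse_coef N.+1)%:R * s ^+ N.+1) <= 8^-1 ^+ N.+1.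
  rewrite ComplexField.Normc.normcM normc_nat normcX.
  have -> : (8^-1 : R) ^+ N.+1 = 27 ^+ N.+1 * 216^-1 ^+ N.+1.
    by rewrite -exprMn; congr (_ ^+ _); field.
  apply: ler_pM; rewrite ?exprn_ge0 ?normc_ge0//.
    by rewrite -natrX ler_nat hesse_coef_le.
  by rewrite lerXn2r ?nnegrE ?normc_ge0// invr_ge0.
apply: le_trans (lerD IH H) _; rewrite exprS; lra.
Qed.

Lemma normc_hesse_poly N s : normc s <= 216^-1 ->
  2^-1 <= normc (hesse_poly N).[s] <= 2.
Proof.
move=> /(hesse_poly_bound N); set v := (hesse_poly N).[s] => H.
have := normcD_le (v - 1) 1; have := normcB_ge 1 (1 - v).
rewrite subrK subKr -(normcN_eq (1 - v)) opprB ComplexField.Normc.normc1.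
by move=> ? ?; apply/andP; split; lra.
Qed.

(** Uses (N + 1)^2 <= 4^N and a_(N+1) <= 27^(N+1); the rate is 4 * 27 / 216 = 1/2. *)
Lemma normc_hesse_defect N s : normc s <= 216^-1 ->
  normc (hesse_defect N s) <= 27 * 2^-1 ^+ N.
Proof.
move=> s216; rewrite /hesse_defect ComplexField.Normc.normcM normc_nat normcX.
have -> : 27 * 2^-1 ^+ N = (4 ^ N * 27 ^ N.+1)%:R * 216^-1 ^+ N :> R.
  have -> : 2^-1 ^+ N = 4 ^+ N * 27 ^+ N * 216^-1 ^+ N :> R.
    by rewrite -!exprMn; congr (_ ^+ _); field.
  by rewrite natrM !natrX exprS; ring.
apply: ler_pM; rewrite ?exprn_ge0 ?normc_ge0//; last first.
  by rewrite lerXn2r ?nnegrE ?normc_ge0// invr_ge0.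
rewrite ler_nat leq_mul ?hesse_coef_le//.
by rewrite (_ : 4 = 2 ^ 2)%N// -expnM mulnC expnM leq_exp2r// ltn_expl.
Qed.

End HesseSeries.

(** * Approximate uniqueness for a singular second-order equation *)

Section ApproximateSolutions.
Context {R : realType}.

(* With theta = r d/dr, the equation theta (P theta Y) = r Q Y as the system
   Z = P theta Y, Z' = Q Y - D up to a defect D. *)
Definition approx_solution (P Q : R -> R[i]) (eps : R) (Y Y' Z D : R -> R[i]) : Prop :=
  forall r : R, 0 <= r <= 1 ->
  [/\ cderiv Y r (Y' r), cderiv Z r (Q r * Y r - D r), normc (D r) <= eps,
      (r%:C)%C * P r * Y' r = Z r & 4^-1 <= normc (Y r) <= 4].

(* The Wronskian of two approximate solutions vanishes at 0 and has a small
   derivative, hence their quotient is almost constant. *)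
Lemma approx_solution_close P Q eps Y1 Y1' Z1 D1 Y2 Y2' Z2 D2 :
  approx_solution P Q eps Y1 Y1' Z1 D1 -> approx_solution P Q eps Y2 Y2' Z2 D2 ->
  Y1 0 = 1 -> Y2 0 = 1 -> (forall r : R, 0 <= r <= 1 -> 2^-1 <= normc (P r)) ->
  forall r : R, 0 <= r <= 1 -> normc (Y2 r - Y1 r) <= 4096 * eps * r.
Proof.
move=> S1 S2 Y10 Y20 hP.
have r00 : 0 <= (0 : R) <= 1 by rewrite lexx ler01.
have sub (r t : R) : 0 <= r <= 1 -> 0 <= t <= r -> 0 <= t <= 1.
  by move=> /andP[_ r1] /andP[-> tr]; rewrite (le_trans tr r1).
have subo (r t : R) : 0 <= r <= 1 -> 0 < t < r -> 0 <= t <= 1.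
  by move=> r01 /andP[/ltW t0 /ltW tr]; apply: sub r01 _; rewrite t0.
pose W r := Y1 r * Z2 r - Y2 r * Z1 r.
(* In the derivative of [W] the terms with [Q] cancel, and so do those with Y1' Y2' once [Z] is
   replaced by r P Y'; the defects remain. *)
pose W' r := Y2 r * D1 r - Y1 r * D2 r.
have dW (r : R) : 0 <= r <= 1 -> cderiv W r (W' r).
  move=> r01; have [dY1 dZ1 _ e1 _] := S1 r r01; have [dY2 dZ2 _ e2 _] := S2 r r01.
  apply: cderiv_eq (cderivB (cderivM dY1 dZ2) (cderivM dY2 dZ1)) _.
  by rewrite /W' -e1 -e2; ring.
have bW (r : R) : 0 <= r <= 1 -> normc (W r) <= 16 * eps * r.
  move=> r01; have -> : W r = W r - W 0.
    have [_ _ _ e1 _] := S1 0 r00; have [_ _ _ e2 _] := S2 0 r00.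
    by rewrite /W -e1 -e2; ring.
  have -> : 16 * eps * r = 2 * (8 * eps) * r by ring.
  apply: (@cderiv_mean_value_le _ W W') => [|t /(sub _ _ r01)/dW//|t /(subo _ _ r01) t01].
    by case/andP: r01.
  have [_ _ b1 _ /andP[_ c1]] := S1 t t01; have [_ _ b2 _ /andP[_ c2]] := S2 t t01.
  apply: le_trans (normcB_le _ _) _; rewrite !ComplexField.Normc.normcM.
  have -> : 8 * eps = 4 * eps + 4 * eps by ring.
  by apply: lerD; apply: ler_pM => //; apply: normc_ge0.
have n0 (r : R) : 0 <= r <= 1 -> Y1 r != 0.
  by move=> /S1[_ _ _ _ /andP[H _]]; rewrite -normc_gt0; apply: lt_le_trans H; rewrite invr_gt0.
pose V r := Y2 r / Y1 r.
pose V' r := (Y2' r * Y1 r - Y2 r * Y1' r) / Y1 r ^+ 2.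
have dV (r : R) : 0 <= r <= 1 -> cderiv V r (V' r).
  move=> r01; have [dY1 _ _ _ _] := S1 r r01; have [dY2 _ _ _ _] := S2 r r01.
  exact: cderiv_div (n0 _ r01).
have e0 : 0 <= eps by have [_ _ H _ _] := S1 0 r00; apply: le_trans H; apply: normc_ge0.
have bV (r : R) : 0 <= r <= 1 -> normc (V r - 1) <= 1024 * eps * r.
  move=> r01; rewrite (_ : 1 = V 0); last by rewrite /V Y10 Y20 divr1.
  have -> : 1024 * eps * r = 2 * (512 * eps) * r by ring.
  apply: (@cderiv_mean_value_le _ V V') => [|t /(sub _ _ r01)/dV//|t t0].
    by case/andP: r01.
  have t01 := subo _ _ r01 t0; have {}t0 : 0 < t by case/andP: t0.
  have [_ _ _ e1 /andP[c1 _]] := S1 t t01; have [_ _ _ e2 _] := S2 t t01.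
  (* The bound on [W] carries a factor t that cancels the singular factor here. As P Y1^2 is at
     least 1/32 in modulus, 16 eps becomes 16 * 32 = 512 eps. *)
  have E : (t%:C)%C * (P t * Y1 t ^+ 2 * V' t) = W t.
    by rewrite /V' /W -e1 -e2; field; apply: n0.
  have := bW t t01; rewrite -E ComplexField.Normc.normcM normc_real gtr0_norm//.
  rewrite [leRHS]mulrC ler_pM2l// ComplexField.Normc.normcM.
  rewrite [X in X * _]ComplexField.Normc.normcM normcX => H.
  have Y16 : 16^-1 <= normc (Y1 t) ^+ 2.
    have -> : 16^-1 = 4^-1 ^+ 2 :> R by field.
    by rewrite lerXn2r ?nnegrE ?normc_ge0 ?invr_ge0.
  have PY : 32^-1 <= normc (P t) * normc (Y1 t) ^+ 2.
    have -> : 32^-1 = 2^-1 * 16^-1 :> R by field.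
    by apply: ler_pM; rewrite ?invr_ge0// hP.
  have := ler_wpM2r (normc_ge0 (V' t)) PY; lra.
move=> r r01; have -> : Y2 r - Y1 r = (V r - 1) * Y1 r.
  by rewrite mulrBl mul1r divfK// n0.
rewrite ComplexField.Normc.normcM.
have -> : 4096 * eps * r = 1024 * eps * r * 4 by ring.
have [_ _ _ _ /andP[_ c1]] := S1 r r01.
by apply: ler_pM; rewrite ?normc_ge0// bV.
Qed.

End ApproximateSolutions.

(** * Pullback of the hypergeometric equation along a cubic transformation *)

Section CubicTransformation.
Context {R : realType}.
Variables (e a b c : R[i]) (d m : nat).
Implicit Types u : R[i].

(** Leading coefficient of the equation shared by the four pullbacks; it factors as (1 - u) (1 + u)
    (1 + 2u) (2 + u) / 2. *)
Definition ode_P u : R[i] := 1 + 5 / 2 * u - 5 / 2 * u ^+ 3 - u ^+ 4.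
Definition ode_Q u : R[i] := - 1 + 6 * u ^+ 2 + 4 * u ^+ 3.

(* The four arguments of n in the theorem are 27 times instances of [ct_s];
   [ct_R] / ((1 + u) [ct_L]) is its logarithmic derivative u s' / s. *)
Definition ct_L u := 1 + a * u + b * u ^+ 2.
Definition ct_L' u := a + 2 * b * u.
Definition ct_s u := c * u ^+ d.+1 * (1 + u) ^+ m.+1 / ct_L u ^+ 3.
Definition ct_R u :=
  (d.+1%:R * (1 + u) + m.+1%:R * u) * ct_L u - 3 * u * (1 + u) * ct_L' u.
Definition ct_s' u := c * u ^+ d * (1 + u) ^+ m * ct_R u / ct_L u ^+ 4.

Definition ct_Y N u := (hesse_poly N).[ct_s u] / ct_L u.
Definition ct_Y' N u := ((hesse_poly N)^`().[ct_s u] * ct_s' u * ct_L u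
  - (hesse_poly N).[ct_s u] * ct_L' u) / ct_L u ^+ 2.
(** This is P theta Y with theta s eliminated by the first identity of [ct_valid]; the first summand
    then contains the bracket differentiated in [hesse_poly_ode]. *)
Definition ct_Z N u :=
  d.+1%:R * (ct_L u * ((1 - 27%:R *: 'X) * 'X * (hesse_poly N)^`()).[ct_s u])
  - ode_P u * u * ct_L' u / ct_L u ^+ 2 * (hesse_poly N).[ct_s u].
Definition ct_D N u := d.+1%:R * ct_L u * ct_s' u * hesse_defect N (ct_s u).

(* The first identity makes the pulled-back leading coefficient equal to
   [ode_P] (up to the factor d + 1), the second one identifies the remaining
   zeroth-order coefficient with [ode_Q]. *)
Definition ct_valid := forall u,
  d.+1%:R * (ct_L u ^+ 3 - 27 * c * u ^+ d.+1 * (1 + u) ^+ m.+1) * (1 + u) =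
    ct_R u * ode_P u /\
  6 * d.+1%:R * c * u ^+ d * (1 + u) ^+ m * ct_R u
  - (((5 / 2 - 15 / 2 * u ^+ 2 - 4 * u ^+ 3) * u * ct_L' u + ode_P u * ct_L' u
      + ode_P u * u * 2 * b) * ct_L u - 2 * (ode_P u * u * ct_L' u) * ct_L' u)
  = ode_Q u * ct_L u ^+ 2.

Local Notation ray := (fun r : R => (r%:C)%C * e).

Lemma cderiv_ray r : cderiv ray r e.
Proof.
by apply: cderiv_eq (cderivM (cderiv_real r) (cderiv_cst e r)) _; ring.
Qed.

Lemma cderiv_ct_L r : cderiv (fun r => ct_L (ray r)) r (ct_L' (ray r) * e).
Proof.
have H := cderiv_ray r.
apply: cderiv_eq (cderivD (cderivD (cderiv_cst 1 r) (cderivM (cderiv_cst a r) H))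
  (cderivM (cderiv_cst b r) (cderivX 2 H))) _.
by rewrite /ct_L' /=; ring.
Qed.

Lemma cderiv_ct_s r : ct_L (ray r) != 0 ->
  cderiv (fun r => ct_s (ray r)) r (ct_s' (ray r) * e).
Proof.
move=> L0; have H := cderiv_ray r.
apply: cderiv_eq (cderiv_div (cderivM (cderivM (cderiv_cst c r) (cderivX d.+1 H))
  (cderivX m.+1 (cderivD (cderiv_cst 1 r) H))) (cderivX 3 (cderiv_ct_L r)) _) _.
  by rewrite expf_neq0.
move: L0; rewrite /ct_s' /ct_R /= !exprS; set u := ray r; set L := ct_L u => L0.
by field.
Qed.

(** The first identity of [ct_valid] divided by powers of L: it turns P theta s into a multiple of
    (1 - 27 s) s. *)
Lemma ct_key1 u : ct_valid -> ct_L u != 0 ->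
  ode_P u * u * ct_s' u = d.+1%:R * ct_L u ^+ 2 * ((1 - 27 * ct_s u) * ct_s u).
Proof.
move=> /(_ u)[+ _] L0; rewrite /ct_s /ct_s' => E.
have -> : ode_P u * u * (c * u ^+ d * (1 + u) ^+ m * ct_R u / ct_L u ^+ 4) =
  c * u ^+ d.+1 * (1 + u) ^+ m * (ct_R u * ode_P u) / ct_L u ^+ 4.
  by rewrite (exprS u d); field.
by rewrite -E !(exprS u d) !(exprS (1 + u) m); field.
Qed.

(** After [hesse_poly_ode], the terms with A' cancel by [ct_key1] and those with A combine into Q A
    / L by the second identity of [ct_valid]. *)
Lemma cderiv_ct_Z N r : ct_valid -> ct_L (ray r) != 0 ->
  cderiv (fun r => ct_Z N (ray r)) r
    (ode_Q (ray r) * e * ct_Y N (ray r) - ct_D N (ray r) * e).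
Proof.
move=> v L0; have H := cderiv_ray r; have HL := cderiv_ct_L r.
have Hs := cderiv_ct_s L0.
have HP : cderiv (fun r => ode_P (ray r)) r
    ((5 / 2 - 15 / 2 * ray r ^+ 2 - 4 * ray r ^+ 3) * e).
  apply: cderiv_eq (cderivB (cderivB (cderivD (cderiv_cst 1 r)
    (cderivM (cderiv_cst (5 / 2) r) H)) (cderivM (cderiv_cst (5 / 2) r) (cderivX 3 H)))
    (cderivX 4 H)) _.
  by rewrite /=; field.
have HL' : cderiv (fun r => ct_L' (ray r)) r (2 * b * e).
  apply: cderiv_eq (cderivD (cderiv_cst a r) (cderivM (cderiv_cst (2 * b) r) H)) _.
  by ring.
apply: cderiv_eq (cderivB (cderivM (cderiv_cst d.+1%:R r)
   (cderivM HL (cderiv_horner ((1 - 27%:R *: 'X) * 'X * (hesse_poly N)^`()) Hs)))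
   (cderivM (cderiv_div (cderivM (cderivM HP H) HL') (cderivX 2 HL) _)
            (cderiv_horner (hesse_poly N) Hs))) _.
  by rewrite expf_neq0.
rewrite hesse_poly_ode /ct_Y /ct_D.
have K1 := ct_key1 v L0.
have [_ K2] := v (ray r).
rewrite [_.[ct_s _]](_ : _ = (1 - 27 * ct_s (ray r)) * ct_s (ray r)
   * (hesse_poly N)^`().[ct_s (ray r)]); last by rewrite !hornerE.
(* The second identity with c u^d (1 + u)^m R replaced by s' L^4, so that it can be solved for Q. *)
have {}K2 : 6 * d.+1%:R * ct_s' (ray r) * ct_L (ray r) ^+ 4 =
  (((5 / 2 - 15 / 2 * ray r ^+ 2 - 4 * ray r ^+ 3) * ray r * ct_L' (ray r) + ode_P (ray r) * ct_L' (ray r)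
      + ode_P (ray r) * ray r * 2 * b) * ct_L (ray r) - 2 * (ode_P (ray r) * ray r * ct_L' (ray r)) * ct_L' (ray r))
  + ode_Q (ray r) * ct_L (ray r) ^+ 2.
  rewrite -K2 /ct_s'; field; exact: L0.
move: K1 K2 L0; rewrite /=.
set u := ray r; set s := ct_s u; set s' := ct_s' u; set L := ct_L u; set L' := ct_L' u.
set A := (hesse_poly N).[s]; set A' := (hesse_poly N)^`().[s].
set P := ode_P u; set Q := ode_Q u; set D := hesse_defect N s.
set P' := 5 / 2 - _ - _.
move=> K1 K2 L0.
have -> : 2%:R * L ^+ 1 * (L' * e) = 2 * L * L' * e by ring.
have -> : Q = (6 * d.+1%:R * s' * L ^+ 4 - ((P' * u * L' + P * L' + P * u * 2 * b) * L
   - 2 * (P * u * L') * L')) / L ^+ 2.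
  by rewrite K2; field.
apply/subr0_eq; apply: etrans (_ : A' * e * L' / L ^+ 2 *
  (d.+1%:R * L ^+ 2 * ((1 - 27 * s) * s) - P * u * s') = 0).
  by field.
by rewrite K1 subrr mulr0.
Qed.


Lemma cderiv_ct_Y N r : ct_L (ray r) != 0 ->
  cderiv (fun r => ct_Y N (ray r)) r (ct_Y' N (ray r) * e).
Proof.
move=> L0; apply: cderiv_eq (cderiv_div (cderiv_horner (hesse_poly N) (cderiv_ct_s L0))
  (cderiv_ct_L r) L0) _.
by rewrite /ct_Y'; field.
Qed.

Lemma ct_Z_theta N u : ct_valid -> ct_L u != 0 ->
  u * ode_P u * ct_Y' N u = ct_Z N u.
Proof.
move=> v L0; have K1 := ct_key1 v L0; rewrite /ct_Y' /ct_Z.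
rewrite [(_ * _^`()).[_]](_ : _ = (1 - 27 * ct_s u) * ct_s u
   * (hesse_poly N)^`().[ct_s u]); last by rewrite !hornerE.
set A := (hesse_poly N).[_]; set A' := (hesse_poly N)^`().[_].
apply: etrans (_ : A' * (ode_P u * u * ct_s' u) / ct_L u
   - ode_P u * u * A * ct_L' u / ct_L u ^+ 2 = _); first by field.
by rewrite K1; field.
Qed.

Lemma ct_L0 : ct_L 0 = 1.
Proof. by rewrite /ct_L; ring. Qed.

Lemma ct_s0 : ct_s 0 = 0.
Proof. by rewrite /ct_s expr0n /= mulr0 !mul0r. Qed.

Lemma ct_Y0 N : ct_Y N 0 = 1.
Proof. by rewrite /ct_Y ct_s0 hesse_poly0 ct_L0 divr1. Qed.

Lemma ct_R_div u : ct_L u != 0 -> 1 + u != 0 -> ct_R u / ((1 + u) * ct_L u) =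
  d.+1%:R + m.+1%:R * (u / (1 + u)) - 3 * u * (ct_L' u / ct_L u).
Proof. by move=> L0 u0; rewrite /ct_R; field; rewrite L0 u0. Qed.

(** The theta-derivative of the series is A(s) - 1 times that of log s. The part with A = L Y loses
    the denominator L; the other part is to cancel the derivatives of the explicit logarithms. *)
Lemma ct_log_theta N u : ct_L u != 0 -> 1 + u != 0 ->
  u * ((hesse_log N.+1)^`().[ct_s u] * ct_s' u) =
  ct_R u * ct_Y N u / (1 + u) - ct_R u / ((1 + u) * ct_L u).
Proof.
move=> L0 u0.
have E : u * ct_s' u = ct_s u * (ct_R u / ((1 + u) * ct_L u)).
  rewrite /ct_s /ct_s' !(exprS u d) !(exprS (1 + u) m).
  by field; rewrite L0 u0.
rewrite mulrCA E; apply: etrans (_ : ct_s u * (hesse_log N.+1)^`().[ct_s u] *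
  (ct_R u / ((1 + u) * ct_L u)) = _); first by ring.
rewrite hesse_log_deriv /ct_Y.
by field; rewrite L0 u0.
Qed.

Lemma ln_normc_ct_s u : c != 0 -> u != 0 -> ct_L u != 0 -> 1 + u != 0 ->
  ln (normc (ct_s u)) = ln (normc c) + d.+1%:R * ln (normc u)
    + m.+1%:R * ln (normc (1 + u)) - 3 * ln (normc (ct_L u)).
Proof.
rewrite -!normc_gt0 => c0 u0 L0 v0; rewrite /ct_s !ComplexField.Normc.normcM.
rewrite ComplexField.Normc.normcV !normcX.
rewrite lnM ?posrE ?mulr_gt0 ?invr_gt0 ?exprn_gt0// lnV ?posrE ?exprn_gt0//.
rewrite lnM ?posrE ?mulr_gt0 ?exprn_gt0// lnM ?posrE ?exprn_gt0//.
rewrite (lnXn d.+1 u0) (lnXn m.+1 v0) (lnXn 3 L0).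
by rewrite -(mulr_natl (ln (normc u))) -(mulr_natl (ln (normc (1 + u)))) -(mulr_natl (ln _) 3).
Qed.

Section Bounds.
Hypotheses (na : normc a <= 4) (nb : normc b <= 2) (nc : normc c <= 1).
Hypotheses (nd : (d <= 3)%N) (nm : (m <= 3)%N).
Variable u : R[i].
Hypothesis nu : normc u <= 1000^-1 * 100^-1.

Lemma normc_ct_L : 2^-1 <= normc (ct_L u) <= 2.
Proof.
apply: normc_near1; rewrite /ct_L.
have -> : 1 + a * u + b * u ^+ 2 - 1 = a * u + b * u ^+ 2 by ring.
apply: le_trans (normc_le_add (normc_le_mul na nu)
  (normc_le_mul nb (normc_le_exp 2 nu))) _; lra.
Qed.

Lemma ct_L_neq0 : ct_L u != 0.
Proof. by have /andP[H _] := normc_ct_L; rewrite -normc_gt0; apply: lt_le_trans H; lra. Qed.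

Lemma normc_add1 : 2^-1 <= normc (1 + u) <= 2.
Proof. by apply: normc_near1; rewrite addrAC subrr add0r; apply: le_trans nu _; lra. Qed.

Lemma add1_neq0 : 1 + u != 0.
Proof. by have /andP[H _] := normc_add1; rewrite -normc_gt0; apply: lt_le_trans H; lra. Qed.

Lemma normc_ode_P : 2^-1 <= normc (ode_P u) <= 2.
Proof.
apply: normc_near1; rewrite /ode_P.
have n52 : normc (5 / 2 : R[i]) <= 5 / 2.
  by rewrite ComplexField.Normc.normcM ComplexField.Normc.normcV !normc_nat.
have -> : 1 + 5 / 2 * u - 5 / 2 * u ^+ 3 - u ^+ 4 - 1 =
  5 / 2 * u - 5 / 2 * u ^+ 3 - u ^+ 4 by ring.
apply: le_trans (normc_le_sub (normc_le_sub (normc_le_mul n52 nu)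
  (normc_le_mul n52 (normc_le_exp 3 nu))) (normc_le_exp 4 nu)) _; lra.
Qed.

Let nu1 : normc u <= 1.
Proof. by apply: le_trans nu _; lra. Qed.

Lemma normc_ct_R : normc (ct_R u) <= 100.
Proof.
have /andP[_ L2] := normc_ct_L; have /andP[_ u2] := normc_add1.
have d4 : normc (d.+1%:R : R[i]) <= 4 by rewrite normc_nat ler_nat.
have m4 : normc (m.+1%:R : R[i]) <= 4 by rewrite normc_nat ler_nat.
have n2 : normc (2 : R[i]) <= 2 by rewrite normc_nat.
have n3 : normc (3 : R[i]) <= 3 by rewrite normc_nat.
apply: le_trans (normc_le_sub (normc_le_mul
  (normc_le_add (normc_le_mul d4 u2) (normc_le_mul m4 nu1)) L2)
  (normc_le_mul (normc_le_mul (normc_le_mul n3 nu1) u2)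
    (normc_le_add na (normc_le_mul (normc_le_mul n2 nb) nu1)))) _; lra.
Qed.

Let n2m k : (k <= 4)%N -> normc ((1 + u) ^+ k) <= 16.
Proof.
move=> k4; have /andP[_ u2] := normc_add1.
apply: le_trans (normc_le_exp k u2) _.
have -> : 16 = 2 ^+ 4 :> R by ring.
by apply: ler_weXn2l; rewrite ?ler1n.
Qed.

Let nLV k : normc (ct_L u ^+ k)^-1 <= 2 ^+ k.
Proof.
have /andP[L2 _] := normc_ct_L.
rewrite ComplexField.Normc.normcV normcX -exprVn.
rewrite lerXn2r ?nnegrE ?invr_ge0 ?normc_ge0//.
by rewrite -[leRHS]invrK lef_pV2 ?posrE ?normc_gt0 ?ct_L_neq0.
Qed.

(** One factor u supplies 10^-5, while the powers of 1 + u and 1/L contribute at most 16 and 8. *)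
Lemma normc_ct_s : normc (ct_s u) <= 216^-1.
Proof.
rewrite /ct_s exprS.
have ud := normc_le_exp d nu1; rewrite expr1n in ud.
have m4 : (m.+1 <= 4)%N by [].
apply: le_trans (normc_le_mul (normc_le_mul (normc_le_mul nc
  (normc_le_mul nu ud)) (n2m m4)) (nLV 3)) _; lra.
Qed.

Lemma normc_ct_s' : normc (ct_s' u) <= (256 * 100).
Proof.
rewrite /ct_s'.
have ud := normc_le_exp d nu1; rewrite expr1n in ud.
have m4 : (m <= 4)%N by apply: leq_trans nm _.
apply: le_trans (normc_le_mul (normc_le_mul (normc_le_mul (normc_le_mul nc
  ud) (n2m m4)) normc_ct_R) (nLV 4)) _; lra.
Qed.

(** The factors bound d + 1, L, s' and the constant of the defect, in this order. *)
Definition ct_bound : R := 4 * 2 * (256 * 100) * 27.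

Lemma normc_ct_D N : normc (ct_D N u) <= ct_bound * 2^-1 ^+ N.
Proof.
have /andP[_ L2] := normc_ct_L.
have d4 : normc (d.+1%:R : R[i]) <= 4 by rewrite normc_nat ler_nat.
apply: le_trans (normc_le_mul (normc_le_mul (normc_le_mul d4 L2) normc_ct_s')
  (normc_hesse_defect N normc_ct_s)) _.
by rewrite [leLHS]mulrA lexx.
Qed.

Lemma normc_ct_Y N : 4^-1 <= normc (ct_Y N u) <= 4.
Proof.
have /andP[L1 L2] := normc_ct_L.
have /andP[A1 A2] := normc_hesse_poly N normc_ct_s.
have L0 : 0 < normc (ct_L u) by rewrite normc_gt0 ct_L_neq0.
rewrite /ct_Y ComplexField.Normc.normcM ComplexField.Normc.normcV.
by rewrite ler_pdivlMr// ler_pdivrMr//; apply/andP; split; lra.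
Qed.

End Bounds.

(** On the ray u = r e one has r d/dr = u d/du, so the chain rule puts a factor e on Y', Q and the
    defect and leaves P unchanged. *)
Lemma ct_approx_solution N : ct_valid -> normc a <= 4 -> normc b <= 2 -> normc c <= 1 ->
  (d <= 3)%N -> (m <= 3)%N -> normc e <= 1000^-1 * 100^-1 ->
  approx_solution (fun r => ode_P (ray r)) (fun r => ode_Q (ray r) * e)
    (ct_bound * 2^-1 ^+ N) (fun r => ct_Y N (ray r)) (fun r => ct_Y' N (ray r) * e)
    (fun r => ct_Z N (ray r)) (fun r => ct_D N (ray r) * e).
Proof.
move=> v na nb nc nd nm ne r /andP[r0 r1].
have nu : normc (ray r) <= 1000^-1 * 100^-1.
  rewrite ComplexField.Normc.normcM normc_real ger0_norm//.
  by apply: le_trans ne; rewrite ler_piMl// normc_ge0.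
have L0 := ct_L_neq0 na nb nu.
split.
- exact: cderiv_ct_Y.
- exact: cderiv_ct_Z.
- rewrite ComplexField.Normc.normcM -[leRHS]mulr1.
  apply: ler_pM; rewrite ?normc_ge0 ?normc_ct_D//.
  by apply: le_trans ne _; lra.
- by rewrite -ct_Z_theta//; ring.
- exact: normc_ct_Y.
Qed.

End CubicTransformation.

(** * The four transformations of the theorem and their combination *)

Section FourTransformations.
Context {R : realType}.
Implicit Types u e : R[i].

(** The parameters are read off the arguments of n divided by 27. In the second the sign goes into
    c; in the third the factor 2 of 2 + 2u - u^2 is extracted, whence c = 1/16. *)
Lemma ct_valid1 : @ct_valid R 4 1 (1 / 2) 0 3.
Proof. by move=> u; rewrite /ct_R /ct_L /ct_L' /ode_P /ode_Q; split; field. Qed.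

Lemma ct_valid2 : @ct_valid R (- 2) (- 2) (- (1 / 2)) 0 0.
Proof. by move=> u; rewrite /ct_R /ct_L /ct_L' /ode_P /ode_Q; split; field. Qed.

Lemma ct_valid3 : @ct_valid R 1 (- (1 / 2)) (1 / 16) 3 0.
Proof. by move=> u; rewrite /ct_R /ct_L /ct_L' /ode_P /ode_Q; split; field. Qed.

Lemma ct_valid4 : @ct_valid R 1 1 (1 / 4) 1 1.
Proof. by move=> u; rewrite /ct_R /ct_L /ct_L' /ode_P /ode_Q; split; field. Qed.

(** The identity behind the coefficients 1, 1, -2, 3 of the theorem: once all Y coincide, the
    theta-derivative of the combination is Y / (1 + u) times this sum. *)
Lemma ct_R_sum u : ct_R 4 1 0 3 u + ct_R (- 2) (- 2) 0 0 u
  - 2 * ct_R 1 (- (1 / 2)) 3 0 u + 3 * ct_R 1 1 1 1 u = 0.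
Proof. by rewrite /ct_R /ct_L /ct_L'; field. Qed.

Lemma normc_div_nat m n : normc (m%:R / n%:R : R[i]) = m%:R / n%:R.
Proof. by rewrite ComplexField.Normc.normcM ComplexField.Normc.normcV !normc_nat. Qed.

Lemma normc4_le4 : normc (4 : R[i]) <= 4.
Proof. by rewrite normc_nat. Qed.

Lemma normc1_le2 : normc (1 : R[i]) <= 2.
Proof. by rewrite ComplexField.Normc.normc1 ler1n. Qed.

Lemma normc_half_le1 : normc (1 / 2 : R[i]) <= 1.
Proof. by rewrite (normc_div_nat 1 2); lra. Qed.

Lemma normcN2_le4 : normc (- 2 : R[i]) <= 4.
Proof. by rewrite normcN_eq normc_nat ler_nat. Qed.

Lemma normcN2_le2 : normc (- 2 : R[i]) <= 2.
Proof. by rewrite normcN_eq normc_nat. Qed.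

Lemma normcNhalf_le1 : normc (- (1 / 2) : R[i]) <= 1.
Proof. by rewrite normcN_eq; exact: normc_half_le1. Qed.

Lemma normc1_le4 : normc (1 : R[i]) <= 4.
Proof. by rewrite ComplexField.Normc.normc1 ler1n. Qed.

Lemma normcNhalf_le2 : normc (- (1 / 2) : R[i]) <= 2.
Proof. by apply: le_trans normcNhalf_le1 _; rewrite ler1n. Qed.

Lemma normc_sixteenth_le1 : normc (1 / 16 : R[i]) <= 1.
Proof. by rewrite (normc_div_nat 1 16); lra. Qed.

Lemma normc_quarter_le1 : normc (1 / 4 : R[i]) <= 1.
Proof. by rewrite (normc_div_nat 1 4); lra. Qed.

Lemma ct_L_four_neq0 u : normc u <= 1000^-1 * 100^-1 ->
  [/\ ct_L 4 1 u != 0, ct_L (- 2) (- 2) u != 0, ct_L 1 (- (1 / 2)) u != 0,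
      ct_L 1 1 u != 0 & 1 + u != 0].
Proof.
move=> nu.
have := (ct_L_neq0 normc4_le4 normc1_le2 nu,
  ct_L_neq0 normcN2_le4 normcN2_le2 nu, ct_L_neq0 normc1_le4 normcNhalf_le2 nu,
  ct_L_neq0 normc1_le4 normc1_le2 nu, add1_neq0 nu).
by move=> [[[[]]]].
Qed.

Let L1 := @ct_L R 4 1.
Let L2 := @ct_L R (- 2) (- 2).
Let L3 := @ct_L R 1 (- (1 / 2)).
Let L4 := @ct_L R 1 1.
Let s1 := @ct_s R 4 1 (1 / 2) 0 3.
Let s2 := @ct_s R (- 2) (- 2) (- (1 / 2)) 0 0.
Let s3 := @ct_s R 1 (- (1 / 2)) (1 / 16) 3 0.
Let s4 := @ct_s R 1 1 (1 / 4) 1 1.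

Let H N (s : R[i]) := complex.Re (hesse_log N.+1).[s].

(* The combination of the logarithms with their singular parts ln |u| cancelled. *)
Definition log_sum N u : R :=
  9 * ln (normc (1 + u)) - 3 * ln (normc (L1 u)) - 3 * ln (normc (L2 u))
  + 6 * ln (normc (L3 u)) - 9 * ln (normc (L4 u))
  + (H N (s1 u) + H N (s2 u) - 2 * H N (s3 u) + 3 * H N (s4 u)).

(** The combination is 0 at u = 0, and its derivative along the ray is small because the four
    approximate solutions nearly agree. *)
Lemma log_sum_bound N u : normc u <= 1000^-1 * 100^-1 ->
  `|log_sum N u| <= 1200 * (4096 * (ct_bound * 2^-1 ^+ N)).
Proof.
move=> ne; set e := u in ne *.
pose ray (r : R) : R[i] := (r%:C)%C * e.
have nray r : 0 <= r <= 1 -> normc (ray r) <= 1000^-1 * 100^-1.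
  move=> /andP[r0 r1]; rewrite ComplexField.Normc.normcM normc_real ger0_norm//.
  by apply: le_trans ne; rewrite ler_piMl// normc_ge0.
have S1 := ct_approx_solution N ct_valid1 normc4_le4 normc1_le2 normc_half_le1 isT isT ne.
have S2 := ct_approx_solution N ct_valid2 normcN2_le4 normcN2_le2 normcNhalf_le1 isT isT ne.
have S3 := ct_approx_solution N ct_valid3 normc1_le4 normcNhalf_le2 normc_sixteenth_le1 isT isT ne.
have S4 := ct_approx_solution N ct_valid4 normc1_le4 normc1_le2 normc_quarter_le1 isT isT ne.
have hP (r : R) : 0 <= r <= 1 -> 2^-1 <= normc (ode_P (ray r)).
  by move=> /nray/normc_ode_P/andP[].
have ray0 : ray 0 = 0 by rewrite /ray mul0r.
have B2 := approx_solution_close S1 S2 (etrans (congr1 _ ray0) (ct_Y0 _ _ _ _ _ _))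
   (etrans (congr1 _ ray0) (ct_Y0 _ _ _ _ _ _)) hP.
have B3 := approx_solution_close S1 S3 (etrans (congr1 _ ray0) (ct_Y0 _ _ _ _ _ _))
   (etrans (congr1 _ ray0) (ct_Y0 _ _ _ _ _ _)) hP.
have B4 := approx_solution_close S1 S4 (etrans (congr1 _ ray0) (ct_Y0 _ _ _ _ _ _))
   (etrans (congr1 _ ray0) (ct_Y0 _ _ _ _ _ _)) hP.
pose G u := 9 / (1 + u) - 3 * (ct_L' 4 1 u / L1 u) - 3 * (ct_L' (- 2) (- 2) u / L2 u)
  + 6 * (ct_L' 1 (- (1 / 2)) u / L3 u) - 9 * (ct_L' 1 1 u / L4 u)
  + ((hesse_log N.+1)^`().[s1 u] * ct_s' 4 1 (1 / 2) 0 3 u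
  + (hesse_log N.+1)^`().[s2 u] * ct_s' (- 2) (- 2) (- (1 / 2)) 0 0 u
  - 2 * ((hesse_log N.+1)^`().[s3 u] * ct_s' 1 (- (1 / 2)) (1 / 16) 3 0 u)
  + 3 * ((hesse_log N.+1)^`().[s4 u] * ct_s' 1 1 (1 / 4) 1 1 u)).
pose Phi r := log_sum N (ray r).
have dPhi (r : R) : 0 <= r <= 1 -> is_derive r 1 Phi (complex.Re (G (ray r) * e)).
  move=> /nray nr.
  have [l1 l2 l3 l4 v0] := ct_L_four_neq0 nr.
  have dv : cderiv (fun r => 1 + ray r) r e.
    by rewrite -[X in cderiv _ _ X]add0r; exact: cderivD (cderiv_cst 1 r) (cderiv_ray e r).
  have dH (s : R -> R[i]) s' : cderiv s r s' ->
      is_derive r 1 (fun x => H N (s x)) (complex.Re ((hesse_log N.+1)^`().[s r] * s')).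
    by move=> ds; have [] := cderiv_horner (hesse_log N.+1) ds.
  have D1 := cderiv_ln_normc (cderiv_ct_L e 4 1 r) l1.
  have D2 := cderiv_ln_normc (cderiv_ct_L e (- 2) (- 2) r) l2.
  have D3 := cderiv_ln_normc (cderiv_ct_L e 1 (- (1 / 2)) r) l3.
  have D4 := cderiv_ln_normc (cderiv_ct_L e 1 1 r) l4.
  have E1 := dH _ _ (@cderiv_ct_s _ e 4 1 (1 / 2) 0 3 r l1).
  have E2 := dH _ _ (@cderiv_ct_s _ e (- 2) (- 2) (- (1 / 2)) 0 0 r l2).
  have E3 := dH _ _ (@cderiv_ct_s _ e 1 (- (1 / 2)) (1 / 16) 3 0 r l3).
  have E4 := dH _ _ (@cderiv_ct_s _ e 1 1 (1 / 4) 1 1 r l4).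
  apply: is_derive_eq (is_derive_add (is_derive_sub (is_derive_add (is_derive_sub
    (is_derive_sub (is_derive_scale 9 (cderiv_ln_normc dv v0)) (is_derive_scale 3 D1))
    (is_derive_scale 3 D2)) (is_derive_scale 6 D3)) (is_derive_scale 9 D4))
    (is_derive_add (is_derive_sub (is_derive_add E1 E2) (is_derive_scale 2 E3))
    (is_derive_scale 3 E4))) _.
  rewrite -!cRe_natM -!(cReD, cReB); congr complex.Re.
  by rewrite /G /L1 /L2 /L3 /L4 /s1 /s2 /s3 /s4 /ray; ring.
have -> : log_sum N e = Phi 1 - Phi 0.
  rewrite /Phi ray0 /ray mul1r [X in _ - X](_ : _ = 0) ?subr0//.
  rewrite /log_sum /L1 /L2 /L3 /L4 !ct_L0 addr0 /H /s1 /s2 /s3 /s4 !ct_s0 hesse_log0.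
  by rewrite ComplexField.Normc.normc1 ln1 /=; ring.
rewrite -[leRHS]mulr1; apply: (mean_value_le ler01 dPhi) => r /andP[r0 r1].
have r01 : 0 <= r <= 1 by rewrite !ltW.
have nr := nray r r01.
apply: le_trans (ler_Re_normc _) _.
(* Multiplication by r turns the derivative into a theta-derivative; it is paid back by the factor r
   in [B2], [B3] and [B4]. *)
rewrite -(ler_pM2l r0) -{1}(gtr0_norm r0) -normc_real -ComplexField.Normc.normcM.
have [l1 l2 l3 l4 v0] := ct_L_four_neq0 nr.
(* The explicit logarithms cancel the rational parts of [ct_log_theta]; eliminating the first R by
   [ct_R_sum] leaves differences from the first Y. *)
have -> : (r%:C)%C * (G (ray r) * e) = (ct_R (- 2) (- 2) 0 0 (ray r) *
     (ct_Y (- 2) (- 2) (- (1 / 2)) 0 0 N (ray r) - ct_Y 4 1 (1 / 2) 0 3 N (ray r))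
   - 2 * (ct_R 1 (- (1 / 2)) 3 0 (ray r) *
     (ct_Y 1 (- (1 / 2)) (1 / 16) 3 0 N (ray r) - ct_Y 4 1 (1 / 2) 0 3 N (ray r)))
   + 3 * (ct_R 1 1 1 1 (ray r) *
     (ct_Y 1 1 (1 / 4) 1 1 N (ray r) - ct_Y 4 1 (1 / 2) 0 3 N (ray r)))) / (1 + ray r).
  rewrite mulrCA mulrC -/(ray r).
  move: l1 l2 l3 l4 v0; set x := ray r => l1 l2 l3 l4 v0.
  have := ct_R_sum x => RS.
  have T1 := @ct_log_theta _ 4 1 (1 / 2) 0 3 N x l1 v0.
  have T2 := @ct_log_theta _ (- 2) (- 2) (- (1 / 2)) 0 0 N x l2 v0.
  have T3 := @ct_log_theta _ 1 (- (1 / 2)) (1 / 16) 3 0 N x l3 v0.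
  have T4 := @ct_log_theta _ 1 1 (1 / 4) 1 1 N x l4 v0.
  rewrite ct_R_div// in T1; rewrite ct_R_div// in T2.
  rewrite ct_R_div// in T3; rewrite ct_R_div// in T4.
  have RS1 : ct_R 4 1 0 3 x = - ct_R (- 2) (- 2) 0 0 x
    + 2 * ct_R 1 (- (1 / 2)) 3 0 x - 3 * ct_R 1 1 1 1 x.
    by apply/subr0_eq; rewrite -[RHS]RS; ring.
  apply: etrans (_ : 9 * (x / (1 + x)) - 3 * (x * (ct_L' 4 1 x / L1 x))
    - 3 * (x * (ct_L' (- 2) (- 2) x / L2 x))
    + 6 * (x * (ct_L' 1 (- (1 / 2)) x / L3 x)) - 9 * (x * (ct_L' 1 1 x / L4 x))
    + (x * ((hesse_log N.+1)^`().[s1 x] * ct_s' 4 1 (1 / 2) 0 3 x)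
    + x * ((hesse_log N.+1)^`().[s2 x] * ct_s' (- 2) (- 2) (- (1 / 2)) 0 0 x)
    - 2 * (x * ((hesse_log N.+1)^`().[s3 x] * ct_s' 1 (- (1 / 2)) (1 / 16) 3 0 x))
    + 3 * (x * ((hesse_log N.+1)^`().[s4 x] * ct_s' 1 1 (1 / 4) 1 1 x))) = _).
    by rewrite /G; ring.
  rewrite T1 T2 T3 T4 RS1 -/(L1 x) -/(L2 x) -/(L3 x) -/(L4 x).
  move: (ct_Y 4 1 _ _ _ _ _) (ct_Y _ _ _ 0 0 _ _) (ct_Y _ _ _ 3 0 _ _)
    (ct_Y _ _ _ 1 1 _ _) => Y1 Y2 Y3 Y4.
  move: (ct_R _ _ 0 0 _) (ct_R _ _ 3 0 _) (ct_R _ _ 1 1 _) => R2 R3 R4.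
  move: (ct_L' 4 1 x / L1 x) (ct_L' (- 2) (- 2) x / L2 x) (ct_L' 1 (- (1 / 2)) x / L3 x)
    (ct_L' 1 1 x / L4 x) => q1 q2 q3 q4.
  by field.
have k2 : normc (2 : R[i]) <= 2 by rewrite normc_nat.
have k3 : normc (3 : R[i]) <= 3 by rewrite normc_nat.
have vi : normc (1 + ray r)^-1 <= 2.
  have /andP[v1 _] := normc_add1 nr.
  by rewrite ComplexField.Normc.normcV -[leRHS]invrK lef_pV2 ?posrE ?normc_gt0.
have R2 : normc (ct_R (- 2) (- 2) 0 0 (ray r)) <= 100.
  by apply: normc_ct_R => //; [exact: normcN2_le4|exact: normcN2_le2].
have R3 : normc (ct_R 1 (- (1 / 2)) 3 0 (ray r)) <= 100.
  by apply: normc_ct_R => //; [exact: normc1_le4|exact: normcNhalf_le2].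
have R4 : normc (ct_R 1 1 1 1 (ray r)) <= 100.
  by apply: normc_ct_R => //; [exact: normc1_le4|exact: normc1_le2].
(* Origin of 1200: (1 + 2 + 3) * 100 for the weighted R, times 2 for the inverse of 1 + u. *)
apply: le_trans (normc_le_mul (normc_le_add (normc_le_sub
   (normc_le_mul R2 (B2 r r01))
   (normc_le_mul k2 (normc_le_mul R3 (B3 r r01))))
   (normc_le_mul k3 (normc_le_mul R4 (B4 r r01)))) vi) _.
by rewrite le_eqVlt; apply/orP; left; apply/eqP; ring.
Qed.

(** The powers of u are 1, 1, 4, 2 and the moduli of c are 1/2 to the same powers; both drop out
    because 1 + 1 - 2 * 4 + 3 * 2 = 0. *)
Lemma log_sum_eq (N : nat) (u : R[i]) : u != 0 -> normc u <= 1000^-1 * 100^-1 ->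
  let F s := ln (normc s) + complex.Re (hesse_log N.+1).[s] in
  F (ct_s 4 1 (1 / 2) 0 3 u) + F (ct_s (- 2) (- 2) (- (1 / 2)) 0 0 u)
  - 2 * F (ct_s 1 (- (1 / 2)) (1 / 16) 3 0 u) + 3 * F (ct_s 1 1 (1 / 4) 1 1 u)
  = log_sum N u.
Proof.
move=> u0 nu F.
have [l1 l2 l3 l4 v0] := ct_L_four_neq0 nu.
have c0 n : (1 / n.+1%:R : R[i]) != 0 by rewrite mul1r invr_eq0 pnatr_eq0.
rewrite /F /log_sum !ln_normc_ct_s ?oppr_eq0 ?c0//.
rewrite normcN_eq (normc_div_nat 1 2) (normc_div_nat 1 16) (normc_div_nat 1 4).
have -> : 1%:R / 16%:R = (1%:R / 2%:R) ^+ 4 :> R by field.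
have -> : 1%:R / 4%:R = (1%:R / 2%:R) ^+ 2 :> R by field.
have h : 0 < (1%:R / 2%:R : R) by lra.
by rewrite (lnXn 4 h) (lnXn 2 h); ring.
Qed.

End FourTransformations.

(** * Letting N tend to infinity, and the identity for n *)

Lemma geometric_bound_eq0 (R : realType) (x C : R) :
  (forall N, `|x| <= C * 2^-1 ^+ N) -> x = 0.
Proof.
move=> H; apply/eqP; apply: contraT => x0.
have px : 0 < `|x| by rewrite normr_gt0.
have C0 : 0 <= C / `|x|.
  by rewrite divr_ge0//; have := H 0%N; rewrite expr0 mulr1; apply: le_trans.
have := archi_boundP C0; set N := Num.bound _ => HN.
have : C / `|x| < 2 ^+ N.
  by apply: lt_le_trans HN _; rewrite -natrX ler_nat ltnW// ltn_expl.
rewrite ltr_pdivrMr// mulrC -ltr_pdivrMr ?exprn_gt0// -exprVn => K.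
by have := le_lt_trans (H N) K; rewrite ltxx.
Qed.

Theorem mainTheorem6 (R : realType) :
  exists eps : R, 0 < eps /\
  forall u : R[i], 0 < ComplexField.Normc.normc u -> ComplexField.Normc.normc u < eps ->
    nfun (27 * u * (1 + u) ^+ 4 / (2 * (1 + 4 * u + u ^+ 2) ^+ 3))
    + nfun (- (27 * u * (1 + u) / (2 * (1 - 2 * u - 2 * u ^+ 2) ^+ 3)))
    = 2 * nfun (27 * u ^+ 4 * (1 + u) / (2 * (2 + 2 * u - u ^+ 2) ^+ 3))
      - 3 * nfun (27 * u ^+ 2 * (1 + u) ^+ 2 / (4 * (1 + u + u ^+ 2) ^+ 3)).
Proof.
exists (1000^-1 * 100^-1); split; first by lra.
move=> u; rewrite normc_gt0 => u0 /ltW nu.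
have [l1 l2 l3 l4 v0] := ct_L_four_neq0 nu.
have c0 n : (1 / n.+1%:R : R[i]) != 0 by rewrite mul1r invr_eq0 pnatr_eq0.
have s0 (a b c : R[i]) d m : c != 0 -> ct_L a b u != 0 -> ct_s a b c d m u != 0.
  by move=> c_neq0 L0; rewrite /ct_s !mulf_neq0 ?invr_eq0 ?expf_neq0.
set t1 := 27 * u * (1 + u) ^+ 4 / _; set t2 := - (27 * u * (1 + u) / _).
set t3 := 27 * u ^+ 4 * (1 + u) / _; set t4 := 27 * u ^+ 2 * (1 + u) ^+ 2 / _.
have -> : t1 = 27 * ct_s 4 1 (1 / 2) 0 3 u.
  rewrite /t1 /ct_s /ct_L mul1r; field; rewrite /ct_L mul1r in l1; exact: l1.
have -> : t2 = 27 * ct_s (- 2) (- 2) (- (1 / 2)) 0 0 u.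
  rewrite /t2 /ct_s.
  have -> : 1 - 2 * u - 2 * u ^+ 2 = ct_L (- 2) (- 2) u by rewrite /ct_L; ring.
  by field.
have -> : t3 = 27 * ct_s 1 (- (1 / 2)) (1 / 16) 3 0 u.
  rewrite /t3 /ct_s.
  have -> : 2 + 2 * u - u ^+ 2 = 2 * ct_L 1 (- (1 / 2)) u by rewrite /ct_L; field.
  by field.
have -> : t4 = 27 * ct_s 1 1 (1 / 4) 1 1 u.
  rewrite /t4 /ct_s.
  have -> : 1 + u + u ^+ 2 = ct_L 1 1 u by rewrite /ct_L; ring.
  by field.
apply/subr0_eq.
(* Here 400 = 1200 / 3 comes from the factor 1/3 in [nfun_approx], and 14 = 2 * (1 + 1 + 2 + 3) from
   its four error terms. *)
apply: (@geometric_bound_eq0 _ _ (400 * (4096 * @ct_bound R) + 14)) => N.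
have b1 : normc (ct_s 4 1 (1 / 2) 0 3 u) <= 216^-1
  by apply: normc_ct_s => //; [exact: normc4_le4|exact: normc1_le2|exact: normc_half_le1].
have b2 : normc (ct_s (- 2) (- 2) (- (1 / 2)) 0 0 u) <= 216^-1
  by apply: normc_ct_s => //; [exact: normcN2_le4|exact: normcN2_le2|exact: normcNhalf_le1].
have b3 : normc (ct_s 1 (- (1 / 2)) (1 / 16) 3 0 u) <= 216^-1
  by apply: normc_ct_s => //; [exact: normc1_le4|exact: normcNhalf_le2|exact: normc_sixteenth_le1].
have b4 : normc (ct_s 1 1 (1 / 4) 1 1 u) <= 216^-1
  by apply: normc_ct_s => //; [exact: normc1_le4|exact: normc1_le2|exact: normc_quarter_le1].
have c2 : - (1 / 2) != 0 :> R[i] by rewrite oppr_eq0 (c0 1%N).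
have := nfun_approx N (s0 _ _ _ 0%N 3%N (c0 1%N) l1) b1.
have := nfun_approx N (s0 _ _ _ 0%N 0%N c2 l2) b2.
have := nfun_approx N (s0 _ _ _ 3%N 0%N (c0 15%N) l3) b3.
have := nfun_approx N (s0 _ _ _ 1%N 1%N (c0 3%N) l4) b4.
have := log_sum_bound N nu; rewrite -(log_sum_eq N u0 nu).
(* With the Mahler measures and the logarithmic sums made opaque, only linear inequalities
   remain. *)
move: (nfun _) (nfun _) (nfun _) (nfun _) => n1 n2 n3 n4.
move: (ln _ + _) (ln _ + _) (ln _ + _) (ln _ + _) => F1 F2 F3 F4.
move: (@ct_bound R) (2^-1 ^+ N) => K q.
have -> : (400 * (4096 * K) + 14) * q = 400 * (4096 * (K * q)) + 14 * q by ring.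
move: (4096 * (K * q)) => B.
rewrite !ler_norml => /andP[? ?] /andP[? ?] /andP[? ?] /andP[? ?] /andP[? ?].
apply/andP; split; lra.
Qed.
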